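(* Let $G\rightrightarrows G_0$ be a Lie groupoid with Lie algebroid $A$ and anchor $\rho:A\to TG_0$, and let $\pi:P\to M$ be a principal $G$-bundle with moment map $\epsilon:P\to G_0$. Let $H\subset TP$ be a horizontal distribution on $P$ with connection 1-form $\alpha\in\Omega^1(P,\epsilon^*A)$, and let $\alpha^\sharp:TP\to A$ be the corresponding vector bundle map over $\epsilon$. Then: (1) $H$ satisfies the Moerdijk–Mrčun condition $\epsilon_*H=0$ if and only if $\rho\circ\alpha^\sharp=\epsilon_*$. (2) $H$ is a principal connection if and only if, in addition (i.e. $\rho\circ\alpha^\sharp=\epsilon_*$ holds and), $\alpha$ is equivariant, meaning that for every local bisection $\gamma$ of $G$, $$R_\gamma^*\alpha=\operatorname{Ad}_{\gamma^{-1}}\alpha .$$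
   Context: Groupoid conventions: $s,t:G\to G_0$ are source and target, $1:G_0\to G$ the unit map; the product $gh$ is defined when $t(g)=s(h)$, and then $s(gh)=s(g)$, $t(gh)=t(h)$. The Lie algebroid $A$ of $G$ has fibre $A_x=\ker(s_* )_{1_x}$ and anchor $\rho=t_*$. A right action of $G$ on a manifold $P$ along $\epsilon:P\to G_0$ is a smooth map $\mu:P\,{}_\epsilon\!\times_s G=\{(p,g):\epsilon(p)=s(g)\}\to P$, $(p,g)\mapsto pg$, with $\epsilon(pg)=t(g)$, $p\cdot1_{\epsilon(p)}=p$, $p(gh)=(pg)h$. A principal $G$-bundle is a smooth fibre bundle $\pi:P\to M$ with such an action preserving the fibres of $\pi$ and such that $P\,{}_\epsilon\!\times_s G\to P\times_M P$, $(p,g)\mapsto(p,pg)$, is a diffeomorphism. The division map $\delta:P\times_M P\to G$ is defined by $p\cdot\delta(p,q)=q$; put $\delta_p=\delta(p,\cdot):P_{\pi(p)}\to s^{-1}(\epsilon(p))$, a diffeomorphism. A horizontal distribution is a subbundle $H\subset TP$ with $TP=\ker\pi_*\oplus H$; $\mathrm{Ver}$ denotes the projection onto $\ker\pi_*$. Its connection 1-form is $\alpha(X_p)=(\delta_p)_{*,p}\mathrm{Ver}(X_p)\in A_{\epsilon(p)}$ for $X_p\in T_pP$; $\alpha^\sharp$ is the same object regarded as a bundle map $TP\to A$ over $\epsilon$. $H$ satisfies the Moerdijk–Mrčun condition if $\epsilon_*H=0$; then for $v\in H_p$ and $g$ with $s(g)=\epsilon(p)$ one defines $(R_g)_*v=\mu_*(v,0_g)$.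 $H$ is a principal connection if it satisfies the Moerdijk–Mrčun condition and $H_{pg}=(R_g)_*H_p$ for all $(p,g)\in P\,{}_\epsilon\!\times_s G$. A local bisection of $G$ is a smooth map $\gamma:U\to G$, $U\subset G_0$ open, with $s\circ\gamma=\mathrm{id}_U$ and $t\circ\gamma$ a diffeomorphism onto an open subset of $G_0$. It acts by $R_\gamma:\epsilon^{-1}(U)\to P$, $p\mapsto p\cdot\gamma(\epsilon(p))$. $\operatorname{Ad}_{\gamma^{-1}}$ is the isomorphism $A|_U\to A|_{t(\gamma(U))}$ (over $t\circ\gamma$) obtained by differentiating at units the conjugation $g\mapsto\gamma(s(g))^{-1}\,g\,\gamma(t(g))$. The equivariance equation means $\alpha((R_\gamma)_*v)=\operatorname{Ad}_{\gamma^{-1}}(\alpha(v))$ for all $v\in T_pP$, $p\in\epsilon^{-1}(U)$. *)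

(* Defs.v *)
From HB Require Import structures.
From mathcomp Require Import all_boot all_order all_algebra.
From mathcomp Require Import all_classical all_reals all_analysis.

Set Implicit Arguments.
Unset Strict Implicit.
Unset Printing Implicit Defensive.

Import Order.TTheory GRing.Theory Num.Theory.
Import numFieldNormedType.Exports.

Local Open Scope classical_set_scope.
Local Open Scope ring_scope.

(* f is C^k on some neighbourhood of a (which may depend on k): in finite
   dimension f is C^(k+1) iff it is differentiable with all its directional
   derivatives C^k. *)
Fixpoint Ck (R : realType) (m n k : nat) (f : 'rV[R]_m -> 'rV[R]_n)
    (a : 'rV[R]_m) : Prop :=
  if k is k'.+1 then
    (\forall x \near a, differentiable f x) /\
    (forall v, Ck k' (fun x => 'D_v f x) a)
  else \forall x \near a, {for x, continuous f}.

(* Because of the dependence on k this is only meaningful as a notion of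
   smoothness when it is required at all points of an open set. *)
Definition Cinf (R : realType) (m n : nat) (f : 'rV[R]_m -> 'rV[R]_n) a :=
  forall k, Ck k f a.

(* A chart is given by total functions; only the values of chart_map on
   chart_dom, and those of chart_inv on the image of chart_dom, matter. *)
Record chart (R : realType) (T : topologicalType) (n : nat) := Chart {
  chart_dom : set T;
  chart_map :> T -> 'rV[R]_n;
  chart_inv : 'rV[R]_n -> T;
  chart_dom_open : open chart_dom;
  chart_img_open : open (chart_map @` chart_dom);
  chart_mapK : forall x, chart_dom x -> chart_inv (chart_map x) = x;
  chart_map_cont : forall x, chart_dom x -> {for x, continuous chart_map};
  chart_inv_cont : forall x, chart_dom x ->
    {for chart_map x, continuous chart_inv}
}.

(* The smooth structure is given by an atlas indexed by the points, chart_at x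
   being a chart around x; every smooth atlas contains such a subatlas, which
   defines the same structure. *)
Record manifold (R : realType) := Manifold {
  carrier :> topologicalType;
  mdim : nat;
  mfd_hausdorff : hausdorff_space carrier;
  mfd_second_countable : @second_countable carrier;
  chart_at : carrier -> chart R carrier mdim;
  chart_at_dom : forall x, chart_dom (chart_at x) x;
  chart_at_compat : forall x y z,
    chart_dom (chart_at x) z -> chart_dom (chart_at y) z ->
    Cinf (chart_at y \o chart_inv (chart_at x)) (chart_at x z)
}.

Arguments chart_at {R m} x : rename.

Section ProductManifold.
Context {R : realType}.

Lemma near_eq_differentiable m n (f g : 'rV[R]_m -> 'rV[R]_n) a :
  (\forall x \near a, f x = g x) -> differentiable f a -> differentiable g a.
Proof.
move=> fg /diff_locallyP[dc fE].
have fga : f a = g a := nbhs_singleton fg.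
have gE : g \o shift a = cst (g a) + 'd f a +o_ (0 : 'rV[R]_m) id.
  apply/eqaddoP => e e0; move/eqaddoP : fE => /(_ e e0).
  have fgh : \forall h \near (0 : 'rV[R]_m), f (h + a) = g (h + a).
    by move: fg; rewrite (near_shift 0); apply: filterS => h /=; rewrite subr0.
  apply: filterS2 fgh => h fgh.
  rewrite -[X in _ -> `|X| <= _]/(g (h + a) - (g a + 'd f a h)) -fga -fgh.
  by [].
have dE : 'd g a = 'd f a :> (_ -> _) by exact: diff_unique.
by apply/diff_locallyP; rewrite dE; split; [exact: dc|exact: gE].
Qed.

Lemma Ck_near m n k (f g : 'rV[R]_m -> 'rV[R]_n) a :
  (\forall x \near a, f x = g x) -> Ck k f a -> Ck k g a.
Proof.
elim: k f g => [|k IHk] f g /near_join fg /=.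
  move=> cf; apply: filterS2 fg cf => x fgx cfx.
  rewrite /prop_for /continuous_at -(nbhs_singleton fgx).
  by apply: cvg_trans cfx; exact: (near_eq_cvg fgx).
case=> df Df; split.
  by apply: filterS2 fg df => x; exact: near_eq_differentiable.
move=> v; apply: IHk (Df v); apply: filterS fg => x fgx.
exact: near_eq_derive.
Qed.

Let continuous_rowl (m n : nat) :
  continuous (fun A : 'rV[R]_m => row_mx A (0 : 'rV[R]_n)).
Proof.
move=> u A /nbhs_ballP[e /= e0 eA].
apply/nbhs_ballP; exists e => //= v [_ uv]; apply: eA; split => // i j.
rewrite !mxE; case: fintype.splitP => k _; first exact: uv.
by rewrite !mxE; exact: ballxx.
Qed.

Let continuous_rowr (m n : nat) :
  continuous (fun A : 'rV[R]_n => row_mx (0 : 'rV[R]_m) A).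
Proof.
move=> u A /nbhs_ballP[e /= e0 eA].
apply/nbhs_ballP; exists e => //= v [_ uv]; apply: eA; split => // i j.
rewrite !mxE; case: fintype.splitP => k _; last exact: uv.
by rewrite !mxE; exact: ballxx.
Qed.

Let rowl_linear (m n : nat) :
  linear (fun A : 'rV[R]_m => row_mx A (0 : 'rV[R]_n)).
Proof. by move=> c A B; rewrite scale_row_mx add_row_mx scaler0 addr0. Qed.

Let rowr_linear (m n : nat) :
  linear (fun A : 'rV[R]_n => row_mx (0 : 'rV[R]_m) A).
Proof. by move=> c A B; rewrite scale_row_mx add_row_mx scaler0 addr0. Qed.

Let rowlL (m n : nat) : {linear 'rV[R]_m -> 'rV[R]_(m + n)} :=
  HB.pack (fun A : 'rV[R]_m => row_mx A (0 : 'rV[R]_n))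
    (GRing.isLinear.Build _ _ _ _ _ (@rowl_linear m n)).

Let rowrL (m n : nat) : {linear 'rV[R]_n -> 'rV[R]_(m + n)} :=
  HB.pack (fun A : 'rV[R]_n => row_mx (0 : 'rV[R]_m) A)
    (GRing.isLinear.Build _ _ _ _ _ (@rowr_linear m n)).

Let is_diff_row (m n m' n' : nat) (f : 'rV[R]_m -> 'rV[R]_m')
    (g : 'rV[R]_n -> 'rV[R]_n') (z : 'rV[R]_(m + n)) :
  differentiable f (lsubmx z) -> differentiable g (rsubmx z) ->
  is_diff z (fun z => row_mx (f (lsubmx z)) (g (rsubmx z)))
    (fun v => row_mx ('d f (lsubmx z) (lsubmx v)) ('d g (rsubmx z) (rsubmx v))).
Proof.
move=> df dg.
have -> : (fun z => row_mx (f (lsubmx z)) (g (rsubmx z))) =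
    (rowlL m' n' \o (f \o lsubmx)) + (rowrL m' n' \o (g \o rsubmx)).
  by apply/funext => y /=; rewrite fctE /= add_row_mx addr0 add0r.
have dl := @differentiable_lsubmx R 1 m n z.
have dr := @differentiable_rsubmx R 1 m n z.
have dL y : differentiable (rowlL m' n') y.
  by apply: linear_differentiable; exact: continuous_rowl.
have dR y : differentiable (rowrL m' n') y.
  by apply: linear_differentiable; exact: continuous_rowr.
have dfl : differentiable (f \o lsubmx) z by exact: differentiable_comp.
have dgr : differentiable (g \o rsubmx) z by exact: differentiable_comp.
have dF : differentiable (rowlL m' n' \o (f \o lsubmx)) z.
  by apply: differentiable_comp => //; exact: dL.
have dG : differentiable (rowrL m' n' \o (g \o rsubmx)) z.
  by apply: differentiable_comp => //; exact: dR.
apply: DiffDef; first exact: differentiableD.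
have eF := diff_comp dfl (dL (f (lsubmx z))).
have eG := diff_comp dgr (dR (g (rsubmx z))).
have ef := diff_comp dl df.
have eg := diff_comp dr dg.
have eL y := diff_lin (f := rowlL m' n') y (@continuous_rowl m' n').
have eR y := diff_lin (f := rowrL m' n') y (@continuous_rowr m' n').
have el : 'd (@lsubmx R 1 m n) z = @lsubmx R 1 m n :> (_ -> _).
  by apply: diff_lin; exact: continuous_lsubmx.
have er : 'd (@rsubmx R 1 m n) z = @rsubmx R 1 m n :> (_ -> _).
  by apply: diff_lin; exact: continuous_rsubmx.
apply/funext => v.
have eFv : 'd (rowlL m' n' \o (f \o lsubmx)) z v =
    row_mx ('d f (lsubmx z) (lsubmx v)) 0.
  by rewrite eF /= eL ef /= el.
have eGv : 'd (rowrL m' n' \o (g \o rsubmx)) z v =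
    row_mx 0 ('d g (rsubmx z) (rsubmx v)).
  by rewrite eG /= eR eg /= er.
apply: (etrans (congr1 (@^~ v) (diffD dF dG))).
apply: (etrans (congr2 +%R eFv eGv)).
by rewrite add_row_mx addr0 add0r.
Qed.

Lemma Ck_row (m n m' n' k : nat) (f : 'rV[R]_m -> 'rV[R]_m')
    (g : 'rV[R]_n -> 'rV[R]_n') (a : 'rV[R]_(m + n)) :
  Ck k f (lsubmx a) -> Ck k g (rsubmx a) ->
  Ck k (fun z => row_mx (f (lsubmx z)) (g (rsubmx z))) a.
Proof.
have nearl (P : set 'rV[R]_m) : (\forall x \near lsubmx a, P x) ->
  \forall z \near a, P (lsubmx z) by exact: (@continuous_lsubmx R 1 m n a P).
have nearr (P : set 'rV[R]_n) : (\forall x \near rsubmx a, P x) ->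
  \forall z \near a, P (rsubmx z) by exact: (@continuous_rsubmx R 1 m n a P).
elim: k f g => [|k IHk] f g /=.
  move=> /nearl cf /nearr cg.
  apply: filterS2 cf cg => x /= cf cg.
  have -> : (fun z => row_mx (f (lsubmx z)) (g (rsubmx z))) =
    ((fun z : 'rV_(m + n) => row_mx (f (lsubmx z)) (0 : 'rV_n')) \+
     (fun z : 'rV_(m + n) => row_mx (0 : 'rV_m') (g (rsubmx z)))).
    by apply/funext => y /=; rewrite add_row_mx addr0 add0r.
  have cl : {for x, continuous (f \o lsubmx)}.
    exact: (continuous_comp (@continuous_lsubmx R 1 m n x) cf).
  have cr : {for x, continuous (g \o rsubmx)}.
    exact: (continuous_comp (@continuous_rsubmx R 1 m n x) cg).
  apply: continuousD.
    exact: (continuous_comp cl (@continuous_rowl m' n' _)).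
  exact: (continuous_comp cr (@continuous_rowr m' n' _)).
move=> [/nearl df Df] [/nearr dg Dg]; split.
  by apply: filterS2 df dg => x dfx dgx; have [] := is_diff_row dfx dgx.
move=> v; apply: Ck_near (IHk _ _ (Df (lsubmx v)) (Dg (rsubmx v))).
apply: filterS2 df dg => x dfx dgx; have [dh dhE] := is_diff_row dfx dgx.
by rewrite !deriveE// dhE.
Qed.

Section ProdChart.
Context {T U : topologicalType} {m n : nat}.
Variables (c : chart R T m) (d : chart R U n).

Let dom := [set z : T * U | chart_dom c z.1 /\ chart_dom d z.2].
Let map (z : T * U) := row_mx (c z.1) (d z.2).
Let inv (v : 'rV[R]_(m + n)) :=
  (chart_inv c (lsubmx v), chart_inv d (rsubmx v)).

Let dom_open : open dom.
Proof.
have -> : dom = (chart_dom c `*` chart_dom d) by apply/seteqP; split.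
rewrite openE => -[x y] [/= cx dy]; exists (chart_dom c, chart_dom d) => //.
by split; apply: open_nbhs_nbhs; split=> //; exact: chart_dom_open.
Qed.

Let img_open : open (map @` dom).
Proof.
have -> : map @` dom = lsubmx @^-1` (c @` chart_dom c) `&`
                       rsubmx @^-1` (d @` chart_dom d).
  apply/seteqP; split=> v /=.
    move=> [[x y] [/= cx dy] <-]; rewrite row_mxKl row_mxKr.
    by split; [exists x|exists y].
  move=> [[x cx xE] [y dy yE]]; exists (x, y) => //=.
  by rewrite /map /= xE yE hsubmxK.
by apply: openI; apply: open_comp; [move=> ? _; exact: continuous_lsubmx|
  exact: chart_img_open|move=> ? _; exact: continuous_rsubmx|
  exact: chart_img_open].
Qed.

Let mapK z : dom z -> inv (map z) = z.
Proof.
by case: z => x y [/= cx dy]; rewrite /inv row_mxKl row_mxKr !chart_mapK.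
Qed.

Let map_cont z : dom z -> {for z, continuous map}.
Proof.
case: z => x y [/= cx dy].
have -> : map = ((fun z : T * U => row_mx (c z.1) (0 : 'rV_n)) \+
                 (fun z : T * U => row_mx (0 : 'rV_m) (d z.2))).
  by apply/funext => z /=; rewrite add_row_mx addr0 add0r.
have cl : {for (x, y), continuous (c \o (@fst T U))}.
  by apply: continuous_comp; [exact: cvg_fst|exact: chart_map_cont].
have cr : {for (x, y), continuous (d \o (@snd T U))}.
  by apply: continuous_comp; [exact: cvg_snd|exact: chart_map_cont].
apply: continuousD.
  exact: (continuous_comp cl (@continuous_rowl m n _)).
exact: (continuous_comp cr (@continuous_rowr m n _)).
Qed.

Let inv_cont z : dom z -> {for map z, continuous inv}.
Proof.
case: z => x y [/= cx dy].
have lE : lsubmx (map (x, y)) = c x by exact: row_mxKl.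
have rE : rsubmx (map (x, y)) = d y by exact: row_mxKr.
have ccont : {for lsubmx (map (x, y)), continuous (chart_inv c)}.
  by rewrite lE; exact: chart_inv_cont.
have dcont : {for rsubmx (map (x, y)), continuous (chart_inv d)}.
  by rewrite rE; exact: chart_inv_cont.
have c1 := continuous_comp (@continuous_lsubmx R 1 m n _) ccont.
have c2 := continuous_comp (@continuous_rsubmx R 1 m n _) dcont.
exact: (cvg_pair c1 c2).
Qed.

Definition prod_chart : chart R (T * U)%type (m + n) :=
  Chart dom_open img_open mapK map_cont inv_cont.

End ProdChart.

Section ProdManifold.
Variables M N : manifold R.

Let prod_hausdorff : hausdorff_space (M * N)%type.
Proof.
move=> [p1 p2] [q1 q2] cl; congr (_, _).
  apply: (@mfd_hausdorff R M) => A B pA qB.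
  have [||[x y] [/= Ax Bx]] := cl (fst @^-1` A) (fst @^-1` B).
  - exact: (@cvg_fst _ _ (nbhs p1) (nbhs p2)).
  - exact: (@cvg_fst _ _ (nbhs q1) (nbhs q2)).
  - by exists x.
apply: (@mfd_hausdorff R N) => A B pA qB.
have [||[x y] [/= Ax Bx]] := cl (snd @^-1` A) (snd @^-1` B).
- exact: (@cvg_snd _ _ (nbhs p1) (nbhs p2)).
- exact: (@cvg_snd _ _ (nbhs q1) (nbhs q2)).
- by exists y.
Qed.

Let prod_second_countable : @second_countable (M * N)%type.
Proof.
have [B1 cB1 [oB1 bB1]] := @mfd_second_countable R M.
have [B2 cB2 [oB2 bB2]] := @mfd_second_countable R N.
exists [set A.1 `*` A.2 | A in B1 `*` B2].
  exact: card_le_trans (card_image_le _ _) (countableX cB1 cB2).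
split=> [_ [[A1 A2] [/= /oB1 oA1 /oB2 oA2] <-]|[x y] W].
  rewrite openE => -[x y] [/= A1x A2y]; exists (A1, A2) => //.
  by split; apply: open_nbhs_nbhs.
move=> [[/= V1 V2] [/= /bB1[A1 [BA1 A1x] AV1] /bB2[A2 [BA2 A2y] AV2]] VW].
exists (A1 `*` A2); first by split=> //; exists (A1, A2).
by move=> [u v] [/= ? ?]; apply: VW; split; [exact: AV1|exact: AV2].
Qed.

Let prod_chart_at (z : M * N) := prod_chart (chart_at z.1) (chart_at z.2).

Let prod_chart_at_dom z : chart_dom (prod_chart_at z) z.
Proof. by split; exact: chart_at_dom. Qed.

Let prod_compat x y z :
  chart_dom (prod_chart_at x) z -> chart_dom (prod_chart_at y) z ->
  Cinf (prod_chart_at y \o chart_inv (prod_chart_at x)) (prod_chart_at x z).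
Proof.
move=> [/= x1 x2] [/= y1 y2] k.
apply: (@Ck_row _ _ _ _ k (chart_at y.1 \o chart_inv (chart_at x.1))
  (chart_at y.2 \o chart_inv (chart_at x.2))).
  by rewrite row_mxKl; exact: chart_at_compat.
by rewrite row_mxKr; exact: chart_at_compat.
Qed.

Definition prod_manifold : manifold R :=
  Manifold prod_hausdorff prod_second_countable prod_chart_at_dom prod_compat.

End ProdManifold.
End ProductManifold.

Section SmoothMaps.
Context {R : realType}.
Implicit Types M N X Y Z : manifold R.

Definition in_charts M N (f : M -> N) (x : M) :
    'rV[R]_(mdim M) -> 'rV[R]_(mdim N) :=
  chart_at (f x) \o f \o chart_inv (chart_at x).

(* As for Cinf, this is used only at all points of an open set. *)
Definition smooth_at M N (f : M -> N) (x : M) :=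
  {for x, continuous f} /\ Cinf (in_charts f x) (chart_at x x).

Definition smooth M N (f : M -> N) := forall x, smooth_at f x.

(* The tangent space T_xM is 'rV[R]_(mdim M): a tangent vector at x is given by
   its components in the chart chart_at x. In a product, (v, w) is row_mx v w. *)
Definition differential M N (f : M -> N) (x : M) :
    'Hom('rV[R]_(mdim M), 'rV[R]_(mdim N)) :=
  linfun ('d (in_charts f x) (chart_at x x)).

Definition submersion M N (f : M -> N) :=
  smooth f /\ forall x, limg (differential f x) = fullv.

(* Maps defined on an embedded submanifold S of X (an open subset, a fibre of
   a submersion, a fibre product over a submersion) are given by functions on X
   whose values outside S are irrelevant. They are smooth when they extend
   locally to smooth maps on X, and their differential on a vector tangent to S
   is that of any such extension. *)
Definition local_extension X Y (S : set X) (f : X -> Y) (x : X) (g : X -> Y) :=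
  \forall y \near x, smooth_at g y /\ (S y -> g y = f y).

Definition smooth_on X Y (S : set X) (f : X -> Y) :=
  forall x, S x -> exists g, local_extension S f x g.

Definition differential_on X Y (S : set X) (f : X -> Y) (x : X) :=
  differential (xget f (local_extension S f x)) x.

Definition diffeo_on X Y (S : set X) (T : set Y) (f : X -> Y) :=
  exists g : Y -> X,
    [/\ smooth_on S f, smooth_on T g,
        forall x, S x -> T (f x) /\ g (f x) = x &
        forall y, T y -> S (g y) /\ f (g y) = y].

Definition fiber_prod X Y Z (f : X -> Z) (g : Y -> Z) :
    set (prod_manifold X Y) :=
  [set z | f z.1 = g z.2].

(* The components, in the chart around x, of the tangent vector v at y. *)
Definition tangent_coord M (x y : M) (v : 'rV[R]_(mdim M)) :
    'rV[R]_(mdim M) :=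
  'd (chart_at x \o chart_inv (chart_at y)) (chart_at y y) v.

Definition smooth_field_at M (V : M -> 'rV[R]_(mdim M)) (x : M) :=
  Cinf (fun z => let y := chart_inv (chart_at x) z in tangent_coord x y (V y))
    (chart_at x x).

(* H is a vector subbundle of TM: it has local smooth frames. *)
Definition smooth_subbundle M (H : M -> {vspace 'rV[R]_(mdim M)}) :=
  forall x : M, exists (k : nat) (V : 'I_k -> M -> 'rV[R]_(mdim M)),
    \forall y \near x, (forall i, smooth_field_at (V i) y) /\
      basis_of (H y) [tuple V i y | i < k].

End SmoothMaps.

(* gmul g h is the product gh, meaningful only when tgt g = src h. *)
Record lie_groupoid (R : realType) (G0 G : manifold R) := LieGroupoid {
  src : G -> G0;
  tgt : G -> G0;
  unt : G0 -> G;
  gmul : G -> G -> G;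
  ginv : G -> G;
  src_submersion : submersion src;
  tgt_submersion : submersion tgt;
  unt_smooth : smooth unt;
  gmul_smooth : smooth_on (fiber_prod tgt src)
    (fun z : prod_manifold G G => gmul z.1 z.2);
  ginv_smooth : smooth ginv;
  src_unt : forall x, src (unt x) = x;
  tgt_unt : forall x, tgt (unt x) = x;
  src_gmul : forall g h, tgt g = src h -> src (gmul g h) = src g;
  tgt_gmul : forall g h, tgt g = src h -> tgt (gmul g h) = tgt h;
  gmulA : forall g h k, tgt g = src h -> tgt h = src k ->
    gmul g (gmul h k) = gmul (gmul g h) k;
  unt_gmul : forall g, gmul (unt (src g)) g = g;
  gmul_unt : forall g, gmul g (unt (tgt g)) = g;
  src_ginv : forall g, src (ginv g) = tgt g;
  tgt_ginv : forall g, tgt (ginv g) = src g;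
  ginv_gmul : forall g, gmul (ginv g) g = unt (tgt g);
  gmul_ginv : forall g, gmul g (ginv g) = unt (src g)
}.

Section Groupoid.
Context {R : realType} {G0 G : manifold R} (Gr : lie_groupoid G0 G).

Definition algebroid_fiber (x : G0) : {vspace 'rV[R]_(mdim G)} :=
  lker (differential (src Gr) (unt Gr x)).

(* The anchor is the restriction to algebroid_fiber x of this map. *)
Definition anchor (x : G0) : 'Hom('rV[R]_(mdim G), 'rV[R]_(mdim G0)) :=
  differential (tgt Gr) (unt Gr x).

Definition local_bisection (U : set G0) (gamma : G0 -> G) :=
  [/\ open U, smooth_on U gamma,
      forall x, U x -> src Gr (gamma x) = x,
      open ((tgt Gr \o gamma) @` U) &
      diffeo_on U ((tgt Gr \o gamma) @` U) (tgt Gr \o gamma)].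

Definition conj_bisection (gamma : G0 -> G) (g : G) : G :=
  gmul Gr (gmul Gr (ginv Gr (gamma (src Gr g))) g) (gamma (tgt Gr g)).

(* Ad_(gamma^-1) at x is the restriction to algebroid_fiber x of this map. *)
Definition Ad_inv (gamma : G0 -> G) (x : G0) :
    'Hom('rV[R]_(mdim G), 'rV[R]_(mdim G)) :=
  differential (conj_bisection gamma) (unt Gr x).

End Groupoid.

(* act p g is the product pg, meaningful only when moment p = src g. In the
   local trivializations the fibre may depend on the base point, hence vary
   between the connected components of M. *)
Record principal_bundle (R : realType) (G0 G : manifold R)
    (Gr : lie_groupoid G0 G) (M P : manifold R) := PrincipalBundle {
  proj : P -> M;
  moment : P -> G0;
  act : P -> G -> P;
  proj_smooth : smooth proj;
  proj_surj : forall x, exists p, proj p = x;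
  proj_locally_trivial : forall x : M,
    exists (U : set M) (F : manifold R) (psi : P -> prod_manifold M F),
      [/\ open U, U x,
          diffeo_on (proj @^-1` U) [set z : prod_manifold M F | U z.1] psi &
          forall p, U (proj p) -> (psi p).1 = proj p];
  moment_smooth : smooth moment;
  act_smooth : smooth_on (fiber_prod moment (src Gr))
    (fun z : prod_manifold P G => act z.1 z.2);
  moment_act : forall p g, moment p = src Gr g -> moment (act p g) = tgt Gr g;
  act_unt : forall p, act p (unt Gr (moment p)) = p;
  act_gmul : forall p g h, moment p = src Gr g -> tgt Gr g = src Gr h ->
    act p (gmul Gr g h) = act (act p g) h;
  proj_act : forall p g, moment p = src Gr g -> proj (act p g) = proj p;
  shear_diffeo :
    diffeo_on (fiber_prod moment (src Gr)) (fiber_prod proj proj)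
      (fun z : prod_manifold P G => (z.1, act z.1 z.2) : prod_manifold P P)
}.

Section Connections.
Context {R : realType} {G0 G : manifold R} {Gr : lie_groupoid G0 G}.
Context {M P : manifold R} (B : principal_bundle Gr M P).
Implicit Types (p q : P) (g : G) (v : 'rV[R]_(mdim P)).
Implicit Types H : P -> {vspace 'rV[R]_(mdim P)}.

Definition division p q : G :=
  xget (unt Gr (moment B p))
    [set g | moment B p = src Gr g /\ act B p g = q].

Definition vertical p : {vspace 'rV[R]_(mdim P)} :=
  lker (differential (proj B) p).

Definition horizontal_distribution H :=
  smooth_subbundle H /\
  forall p, (vertical p + H p = fullv)%VS /\ (vertical p :&: H p = 0)%VS.

Definition Ver H p : 'End('rV[R]_(mdim P)) := daddv_pi (vertical p) (H p).

Definition connection_form H p v : 'rV[R]_(mdim G) :=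
  differential_on [set q | proj B q = proj B p] (division p) p (Ver H p v).

Definition MM_condition H :=
  forall p v, v \in H p -> differential (moment B) p v = 0.

(* mu_* (v, 0_g) *)
Definition right_transl p g v : 'rV[R]_(mdim P) :=
  differential_on (fiber_prod (moment B) (src Gr))
    (fun z : prod_manifold P G => act B z.1 z.2) (p, g)
    (row_mx v (0 : 'rV[R]_(mdim G))).

Definition principal_connection H :=
  MM_condition H /\
  forall p g, moment B p = src Gr g ->
    [set` H (act B p g)] = right_transl p g @` [set` H p].

Definition act_bisection (gamma : G0 -> G) p : P :=
  act B p (gamma (moment B p)).

Definition equivariant H :=
  forall (U : set G0) (gamma : G0 -> G), local_bisection Gr U gamma ->
  forall p v, U (moment B p) ->
    connection_form H (act_bisection gamma p)
      (differential (act_bisection gamma) p v) =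
    Ad_inv Gr gamma (moment B p) (connection_form H p v).

End Connections.

(* Main.v *)
(* Let D_p be the division map q |-> delta(p, q) on the fibre through p, so that
   alpha = dD_p o Ver at p. A vertical vector is the image dj(w) of a vector
   tangent to a parametrization j of the fibre, so identities between maps on
   the fibre can be differentiated. From t(D_p q) = eps(q) one gets
   rho o alpha = d eps on vertical vectors, hence (1); from p . D_p(q) = q one
   gets that alpha is injective on vertical vectors, i.e. ker alpha = H.
   For a local bisection gamma with gamma(eps p) = g, the vector R_g(v) is
   dR_gamma(v) whenever d eps(v) = 0, and D_pg o R_gamma is the conjugate of D_p
   by gamma. So alpha is always equivariant on vertical vectors, and it is
   equivariant on H iff dR_gamma maps H into ker alpha = H. This gives (2), as
   there is a local bisection through every g: by the inverse function theorem
   it suffices to find a common complement of ker ds and ker dt at g. *)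

Require Import Defs.
From HB Require Import structures.
From mathcomp Require Import all_boot all_order all_algebra.
From mathcomp Require Import all_classical all_reals all_analysis.
From mathcomp Require Import ring lra.

Set Implicit Arguments.
Unset Strict Implicit.
Unset Printing Implicit Defensive.

Import Order.TTheory GRing.Theory Num.Theory.
Import numFieldNormedType.Exports.

Local Open Scope classical_set_scope.
Local Open Scope ring_scope.

(** * Functions of class C^k *)

(* The generic filter lemmas, at neighbourhoods only: with a free filter, their
   application fails once the neighbourhoods of a matrix are unfolded. *)
Lemma near_forall (T : topologicalType) (I : finType) (P : I -> T -> Prop)
    (a : T) :
  (forall i, \forall x \near a, P i x) -> \forall x \near a, forall i, P i x.
Proof. exact: filter_forall. Qed.

Lemma near_all (T : topologicalType) (P : T -> Prop) (a : T) :
  (forall x, P x) -> \forall x \near a, P x.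
Proof. exact: nearW. Qed.

Lemma near_imply2 (T : topologicalType) (P Q S : T -> Prop) (a : T) :
  (\forall x \near a, P x) -> (\forall x \near a, Q x) ->
  (forall x, P x -> Q x -> S x) -> \forall x \near a, S x.
Proof. by move=> nP nQ PQS; exact: filterS2 nP nQ. Qed.

Lemma near_and (T : topologicalType) (P Q : T -> Prop) (a : T) :
  (\forall x \near a, P x) -> (\forall x \near a, Q x) ->
  \forall x \near a, P x /\ Q x.
Proof. by move=> nP nQ; exact: filterI nP nQ. Qed.

Lemma near_continuous (S T : topologicalType) (f : S -> T) a (P : T -> Prop) :
  {for a, continuous f} -> (\forall y \near f a, P y) ->
  \forall x \near a, P (f x).
Proof. by move=> cf; exact: cf. Qed.

Lemma near_neq0 (R : realFieldType) (T : topologicalType) (f : T -> R) a :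
  {for a, continuous f} -> f a != 0 -> \forall x \near a, f x != 0.
Proof.
move=> cf fa; apply: (near_continuous (P := fun y => y != 0) cf).
by apply: open_nbhs_nbhs; split=> //; exact: open_neq.
Qed.

Section ScalarCk.
Context {R : realType}.

(** Scalar version of [Ck]: values lie in a field, so closure under products and inverses makes
    sense. [Ck_coordP] reduces [Ck] to it coordinate by coordinate. *)
Fixpoint Cks (m k : nat) (f : 'rV[R]_m -> R) (a : 'rV[R]_m) : Prop :=
  if k is k'.+1 then
    (\forall x \near a, differentiable f x) /\
    (forall v, Cks k' (fun x => 'D_v f x) a)
  else \forall x \near a, {for x, continuous f}.

Lemma differentiable_rowP m n (f : 'rV[R]_m -> 'rV[R]_n) x :
  differentiable f x <-> forall i, differentiable (fun y => f y 0 i) x.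
Proof.
split=> [df i|df].
  exact: (differentiable_comp df (differentiable_coord _ 0 i)).
have -> : f = \sum_(i < n) (fun y => f y 0 i *: (delta_mx 0 i : 'rV[R]_n)).
  by apply/funext => y; rewrite fct_sumE {1}[f y]row_sum_delta.
apply: differentiable_sum => i.
exact: (@differentiableZl _ _ _ (fun y => f y 0 i)).
Qed.

Lemma continuous_rowP m n (f : 'rV[R]_m -> 'rV[R]_n) x :
  {for x, continuous f} <-> forall i, {for x, continuous (fun y => f y 0 i)}.
Proof.
split=> [cf i|cf].
  have cc : {for f x, continuous (fun M : 'rV[R]_n => M 0 i)}.
    exact: coord_continuous.
  exact: continuous_comp cf cc.
move=> A /nbhs_ballP[e /= e0 eA].
have : \forall y \near x, forall i, ball (f x 0 i) e (f y 0 i).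
  by apply: near_forall => i; exact: (cf i _ (nbhsx_ballx (f x 0 i) e e0)).
apply: filterS => y h; apply: eA; split => // i j.
by rewrite (ord1 i); exact: h.
Qed.

Lemma derive_coord (V : normedModType R) n (f : V -> 'rV[R]_n) x v i :
  differentiable f x -> 'D_v (fun y => f y 0 i) x = ('D_v f x) 0 i.
Proof.
by move=> df; rewrite derive_mx ?mxE//; exact: diff_derivable.
Qed.

Lemma derive_sum_delta m (W : normedModType R) (f : 'rV[R]_m -> W) x v :
  differentiable f x ->
  'D_v f x = \sum_(j < m) v 0 j *: 'D_(delta_mx 0 j) f x.
Proof.
move=> df; rewrite deriveE// {1}[v]row_sum_delta linear_sum.
by apply: eq_bigr => j _; rewrite linearZ/= deriveE.
Qed.

Lemma near_eq_differentiable_scalar m (f g : 'rV[R]_m -> R) a :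
  (\forall x \near a, f x = g x) -> differentiable f a -> differentiable g a.
Proof.
move=> fg df.
(* A scalar function is identified with a row of length one, to which the vector version applies. *)
have rowE (h : 'rV[R]_m -> R) :
    differentiable h a <-> differentiable (fun x => \row_(_ < 1) h x) a.
  split=> [dh|/differentiable_rowP/(_ 0)].
    apply/differentiable_rowP => i.
    by have -> : (fun y => (\row_(_ < 1) h y) 0 i) = h
      by apply/funext => y; rewrite mxE.
  by have -> : (fun y => (\row_(_ < 1) h y) 0 0) = h
    by apply/funext => y; rewrite mxE.
apply/rowE; move/rowE : df; apply: near_eq_differentiable.
by apply: filterS fg => x ->.
Qed.

Lemma Cks_near m k (f g : 'rV[R]_m -> R) a :
  (\forall x \near a, f x = g x) -> Cks k f a -> Cks k g a.
Proof.
elim: k f g => [|k IHk] f g /near_join fg /=.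
  move=> cf; apply: filterS2 fg cf => x fgx cfx.
  rewrite /prop_for /continuous_at -(nbhs_singleton fgx).
  by apply: cvg_trans cfx; exact: (near_eq_cvg fgx).
case=> df Df; split.
  by apply: filterS2 fg df => x; exact: near_eq_differentiable_scalar.
move=> v; apply: IHk (Df v); apply: filterS fg => x fgx.
exact: near_eq_derive.
Qed.

Lemma CksW m k (f : 'rV[R]_m -> R) a : Cks k.+1 f a -> Cks k f a.
Proof.
elim: k f => [|k IHk] f [df Df].
  by apply: filterS df => x; exact: differentiable_continuous.
by split=> // v; apply: IHk; exact: Df.
Qed.

Lemma Ck_coordP m n k (f : 'rV[R]_m -> 'rV[R]_n) a :
  Ck k f a <-> forall i, Cks k (fun x => f x 0 i) a.
Proof.
elim: k f => [|k IHk] f /=.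
  split=> [cf i|cf]; first by apply: filterS cf => x /continuous_rowP.
  by apply: filterS (near_forall cf) => x /continuous_rowP.
split=> [[df Df] i|H].
  split; first by apply: filterS df => x /differentiable_rowP.
  move=> v; apply: (@Cks_near _ _ (fun x => ('D_v f x) 0 i)).
    by apply: filterS df => x dfx; rewrite derive_coord.
  by have /IHk := Df v; exact.
have df : \forall x \near a, differentiable f x.
  apply: filterS (near_forall (fun i => (H i).1)) => x.
  by move/differentiable_rowP.
split=> // v; apply/IHk => i.
apply: Cks_near ((H i).2 v).
by apply: filterS df => x dfx; rewrite derive_coord.
Qed.

Lemma Cks_cst m k (c : R) (a : 'rV[R]_m) : Cks k (fun=> c) a.
Proof.
elim: k c => [|k IHk] c; first by apply: near_all => x; exact: cst_continuous.
split=> [|v]; first by apply: near_all => x; exact: differentiable_cst.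
by apply: Cks_near (IHk 0); apply: near_all => x; rewrite derive_cst.
Qed.

Lemma CksD m k (f g : 'rV[R]_m -> R) a :
  Cks k f a -> Cks k g a -> Cks k (fun x => f x + g x) a.
Proof.
elim: k f g => [|k IHk] f g /=.
  by apply: filterS2 => x cf cg; exact: continuousD.
move=> [df Df] [dg Dg]; split.
  by apply: filterS2 df dg => x; exact: differentiableD.
move=> v; apply: Cks_near (IHk _ _ (Df v) (Dg v)).
apply: filterS2 df dg => x dfx dgx.
by rewrite -deriveD//; exact: diff_derivable.
Qed.

(** By the Leibniz rule, the derivative mixes [f] and [g] with their derivatives; [CksW] lowers [f]
    and [g] to the class of the induction hypothesis. *)
Lemma CksM m k (f g : 'rV[R]_m -> R) a :
  Cks k f a -> Cks k g a -> Cks k (fun x => f x * g x) a.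
Proof.
elim: k f g => [|k IHk] f g.
  by apply: filterS2 => x cf cg; exact: continuousM.
move=> Cf Cg; have [df Df] := Cf; have [dg Dg] := Cg; split.
  by apply: filterS2 df dg => x; exact: differentiableM.
move=> v.
have := CksD (IHk _ _ (CksW Cf) (Dg v)) (IHk _ _ (CksW Cg) (Df v)).
apply: Cks_near; apply: filterS2 df dg => x dfx dgx.
by rewrite -[RHS]/('D_v (f * g) x) deriveM//; exact: diff_derivable.
Qed.

Lemma Cks_sum m k (I : Type) (r : seq I) (P : pred I)
    (F : I -> 'rV[R]_m -> R) a :
  (forall i, Cks k (F i) a) -> Cks k (fun x => \sum_(i <- r | P i) F i x) a.
Proof.
move=> CF; elim: r => [|i r IHr].
  by apply: Cks_near (Cks_cst k 0 a); apply: near_all => x; rewrite big_nil.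
case Pi : (P i).
  apply: Cks_near (CksD (CF i) IHr).
  by apply: near_all => x; rewrite big_cons Pi.
by apply: Cks_near IHr; apply: near_all => x; rewrite big_cons Pi.
Qed.

Lemma Cks_prod m k (I : Type) (r : seq I) (P : pred I)
    (F : I -> 'rV[R]_m -> R) a :
  (forall i, Cks k (F i) a) -> Cks k (fun x => \prod_(i <- r | P i) F i x) a.
Proof.
move=> CF; elim: r => [|i r IHr].
  by apply: Cks_near (Cks_cst k 1 a); apply: near_all => x; rewrite big_nil.
case Pi : (P i).
  apply: Cks_near (CksM (CF i) IHr).
  by apply: near_all => x; rewrite big_cons Pi.
by apply: Cks_near IHr; apply: near_all => x; rewrite big_cons Pi.
Qed.

Lemma Cks_cont m k (f : 'rV[R]_m -> R) a : Cks k f a -> {for a, continuous f}.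
Proof.
by elim: k => [/nbhs_singleton//|k IHk /CksW].
Qed.

(** The derivative of 1/f is -(1/f)^2 times that of f, and 1/f is already known to be of the lower
    class by induction. *)
Lemma CksV m k (f : 'rV[R]_m -> R) a :
  f a != 0 -> Cks k f a -> Cks k (fun x => (f x)^-1) a.
Proof.
move=> fa0 C; have f0 := near_neq0 (Cks_cont C) fa0.
elim: k C => [|k IHk] Cf; last first.
  have [df Df] := Cf; split.
    by apply: filterS2 df f0 => x dfx fx0; exact: differentiableV.
  move=> v; have CV := IHk (CksW Cf).
  have := CksM (Cks_cst k (-1) a) (CksM (CksM CV CV) (Df v)).
  apply: Cks_near; apply: filterS2 df f0 => x dfx fx0.
  rewrite -[RHS]/('D_v (fun y => (f y)^-1) x).
  rewrite deriveV//; last exact: diff_derivable.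
  by rewrite mulN1r scaleNr -expr2 exprVn.
by apply: filterS2 Cf f0 => x cf fx0; exact: continuousV.
Qed.

Lemma Cks_coord m k i (a : 'rV[R]_m) : Cks k (fun x => x 0 i) a.
Proof.
case: k => [|k]; first by apply: near_all => x; exact: coord_continuous.
split; first by apply: near_all => x; exact: differentiable_coord.
move=> v; apply: Cks_near (Cks_cst k (v 0 i) a); apply: near_all => x.
by rewrite (@derive_coord _ _ id) ?derive_id//.
Qed.

Lemma CkW m n k (f : 'rV[R]_m -> 'rV[R]_n) a : Ck k.+1 f a -> Ck k f a.
Proof. by move/Ck_coordP => Cf; apply/Ck_coordP => i; exact: CksW. Qed.

Lemma Ck_cont m n k (f : 'rV[R]_m -> 'rV[R]_n) a :
  Ck k f a -> {for a, continuous f}.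
Proof.
by move/Ck_coordP => Cf; apply/continuous_rowP => i; exact: Cks_cont (Cf i).
Qed.

(** The chain rule writes the derivative as a sum over [i] of the [i]-th coordinate of ['D_v g]
    times the [i]-th partial derivative of [f] composed with [g]; induction applies to the second
    factor. *)
Lemma Cks_comp m n k (f : 'rV[R]_n -> R) (g : 'rV[R]_m -> 'rV[R]_n) a :
  Cks k f (g a) -> Ck k g a -> Cks k (f \o g) a.
Proof.
elim: k f => [|k IHk] f.
  move=> /= Cf Cg; have cg := nbhs_singleton Cg.
  apply: filterS2 Cg (cg _ Cf) => x cgx cfx.
  exact: continuous_comp.
move=> Cf Cg; have [df Df] := Cf; have [dg Dg] := Cg.
have dfg := Ck_cont Cg df; split.
  by apply: filterS2 dg dfg => x dgx dfx; exact: differentiable_comp.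
move=> v.
pose F i x := ('D_v g x) 0 i * ((fun y => 'D_(delta_mx 0 i) f y) \o g) x.
suff CF i : Cks k (F i) a.
  apply: (Cks_near _ (Cks_sum (index_enum 'I_n) predT CF)).
  apply: filterS2 dg dfg => x dgx dfx.
  have -> : 'D_v (f \o g) x = 'D_('D_v g x) f (g x).
    rewrite !deriveE//; last exact: differentiable_comp.
    by rewrite diff_comp.
  by rewrite derive_sum_delta.
apply: CksM; first by have /Ck_coordP := Dg v; exact.
by apply: IHk; [exact: Df|exact: CkW].
Qed.

Lemma Ck_comp m n p k (f : 'rV[R]_n -> 'rV[R]_p) (g : 'rV[R]_m -> 'rV[R]_n) a :
  Ck k f (g a) -> Ck k g a -> Ck k (f \o g) a.
Proof.
move=> /Ck_coordP Cf Cg; apply/Ck_coordP => i.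
exact: (@Cks_comp _ _ _ (fun y => f y 0 i)).
Qed.

Lemma Ck_affine m n k (A : 'M[R]_(m, n)) (u : 'rV[R]_m) (w : 'rV[R]_n) a :
  Ck k (fun x => w + (x - u) *m A) a.
Proof.
apply/Ck_coordP => i.
have := @CksD m k _ _ a (Cks_cst k (w 0 i) a) (@Cks_sum m k _ (index_enum 'I_m)
  predT (fun j x => (x 0 j + - u 0 j) * A j i) a
  (fun j => CksM (CksD (Cks_coord k j a) (Cks_cst k (- u 0 j) a))
                 (Cks_cst k (A j i) a))).
apply: Cks_near; apply: near_all => x; rewrite !mxE; congr (_ + _).
by apply: eq_bigr => j _; rewrite !mxE.
Qed.

Lemma Ck_cst m n k (w : 'rV[R]_n) (a : 'rV[R]_m) : Ck k (fun=> w) a.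
Proof. by apply/Ck_coordP => i; exact: Cks_cst. Qed.

Lemma Ck_id m k (a : 'rV[R]_m) : Ck k id a.
Proof. by apply/Ck_coordP => i; exact: Cks_coord. Qed.

Lemma Ck_linear m n k (L : {linear 'rV[R]_m -> 'rV[R]_n}) a : Ck k L a.
Proof.
have -> : (L : _ -> _) = fun y => 0 + (y - 0) *m lin1_mx L.
  by apply/funext => y; rewrite add0r subr0 mul_rV_lin1.
exact: Ck_affine.
Qed.

Lemma linear_rV_continuous m n (L : {linear 'rV[R]_m -> 'rV[R]_n}) :
  continuous L.
Proof. by move=> x; exact: Ck_cont (Ck_linear 0 L x). Qed.

End ScalarCk.

(** * The inverse function theorem *)

(** Completeness of matrix spaces, for the Banach fixed point theorem. *)
HB.instance Definition _ (R : realType) m n :=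
  Uniform_isComplete.Build 'M[R]_(m, n) cauchy_cvg.

Section InverseFunction.
Context {R : realType}.

Lemma rV_norm_leP n (x : 'rV[R]_n) (c : R) : 0 <= c ->
  reflect (forall i, `|x 0 i| <= c) (`|x| <= c).
Proof.
move=> c0; apply: (iffP idP) => [xc i|xc].
  apply: le_trans xc; rewrite /Num.norm/= mx_normrE.
  exact: (le_bigmax _ (fun k : 'I_1 * 'I_n => `|x k.1 k.2|) (0, i)).
rewrite [`|x|]mx_normrE; apply: bigmax_le => // -[i j] _ /=.
by rewrite (ord1 i).
Qed.

(** The scalar mean value theorem is applied to each coordinate along the segment from [y] to [x],
    which stays in the ball by convexity. The factor [n%:R] counts the partial derivatives in the
    expansion of ['D_(x - y)]; norms are sup norms. *)
Lemma mean_value_bound n (h : 'rV[R]_n -> 'rV[R]_n) (a : 'rV[R]_n) (r c : R) :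
  0 <= c ->
  (forall x, ball a r x -> differentiable h x) ->
  (forall x i j, ball a r x -> `|('D_(delta_mx 0 j) h x) 0 i| <= c) ->
  forall x y : 'rV[R]_n, ball a r x -> ball a r y ->
    `|h x - h y| <= n%:R * c * `|x - y|.
Proof.
move=> c0 dh hc x y ax ay.
apply/rV_norm_leP => [|i]; first by rewrite !mulr_ge0.
pose p (t : R) : 'rV[R]_n := y + t *: (x - y).
have ap t : 0 <= t <= 1 -> ball a r (p t).
  move=> /andP[t0 t1]; move: ax ay; rewrite -!ball_normE /ball_ /= => ax ay.
  have -> : a - p t = t *: (a - x) + (1 - t) *: (a - y).
    by apply/rowP => k; rewrite !mxE; ring.
  apply: le_lt_trans (ler_normD _ _) _; rewrite !normrZ !ger0_norm ?subr_ge0//.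
  (* Multiplying a strict inequality by [t] keeps it strict only for nonzero [t]. *)
  have [->|tp] := eqVneq t 0; first by rewrite mul0r subr0 mul1r add0r.
  apply: (@lt_le_trans _ _ (t * r + (1 - t) * r)); last first.
    by rewrite -mulrDl subrKC mul1r.
  rewrite ltr_leD//; first by rewrite ltr_pM2l// lt0r tp.
  by rewrite ler_wpM2l ?subr_ge0// ltW.
pose phi (t : R) : R := h (p t) 0 i.
have dp (t : R) : is_diff t p (fun s : R => s *: (x - y)).
  have -> : p = cst y + ( *:%R ^~ (x - y)) by apply/funext.
  rewrite -[X in is_diff _ _ X]add0r.
  exact: is_diffD.
have dphi (t : R) : 0 <= t <= 1 -> is_derive t 1 phi (('D_(x - y) h (p t)) 0 i).
  move=> t01; have dht := dh _ (ap t t01).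
  have dpt : differentiable p t by case: (dp t).
  have dhp : differentiable (h \o p) t by exact: differentiable_comp.
  have dc (z : 'rV[R]_n) := @differentiable_coord _ _ _ z 0 i.
  have dphit : differentiable phi t by exact: (differentiable_comp dhp (dc _)).
  apply: DeriveDef; first exact: diff_derivable.
  rewrite (derive_coord _ _ dhp) !deriveE//.
  by rewrite diff_comp//= (diff_val (f := p)) scale1r.
have [] := @MVT R phi (fun t => ('D_(x - y) h (p t)) 0 i) 0 1 ltr01.
- move=> t; rewrite in_itv/= => /andP[/ltW t0 /ltW t1].
  by apply: dphi; rewrite t0 t1.
- apply: derivable_within_continuous => t.
  by rewrite in_itv/= => /dphi[].
move=> t; rewrite in_itv/= => /andP[/ltW t0 /ltW t1].
rewrite /phi /p scale1r scale0r addr0 subrKC subr0 mulr1 !mxE => ->.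
have t01 : 0 <= t <= 1 by rewrite t0.
rewrite derive_sum_delta; last exact/dh/ap.
rewrite summxE; apply: le_trans (ler_norm_sum _ _ _) _.
have -> : n%:R * c * `|x - y| = \sum_(j < n) c * `|x - y|.
  by rewrite sumr_const card_ord -mulrA mulr_natl.
apply: ler_sum => j _.
rewrite mxE normrM mulrC ler_pM//; first by apply: hc; exact: ap.
by move: j; exact/rV_norm_leP.
Qed.

(** A solution is a fixed point of [x |-> h x + y]. This contraction preserves the closed ball of
    radius r/2: [h] moves by at most half of r/2, and the distance from [y] to [a - h a] adds less
    than r/4. *)
Lemma perturbed_identity n (h : 'rV[R]_n -> 'rV[R]_n) (a : 'rV[R]_n) (r : R) :
  0 < r ->
  (forall x y : 'rV[R]_n, ball a r x -> ball a r y ->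
    `|h x - h y| <= 2^-1 * `|x - y|) ->
  forall y, `|y - (a - h a)| < r / 4 -> exists2 x, ball a r x & x - h x = y.
Proof.
move=> r0 hlip y ya.
pose U : set 'rV[R]_n := closed_ball_ (fun x => `|x|) a (r / 2).
have Uball x : U x -> ball a r x.
  rewrite -ball_normE /U /closed_ball_ /ball_ /= => /le_lt_trans; apply; lra.
have aball : ball a r a by exact: ballxx.
have Uh x : U x -> U (h x + y).
  move=> Ux; have := hlip _ _ (Uball x Ux) aball.
  move: Ux; rewrite /U /closed_ball_ /= => Ux hx.
  have -> : a - (h x + y) = - ((h x - h a) + (y - (a - h a))).
    by apply/rowP => k; rewrite !mxE; ring.
  rewrite normrN; apply: le_trans (ler_normD _ _) _.
  rewrite distrC in Ux; lra.
pose T := mkfun_fun Uh.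
have cT : is_contraction T.
  have q0 : 0 <= (2^-1 : R) by rewrite invr_ge0.
  exists (NngNum q0); split => /=; first lra.
  move=> -[u v] [/= Uu Uv]; rewrite opprD addrACA subrr addr0.
  by apply: hlip; exact: Uball.
have [] := banach_fixed_point cT.
- exact: closed_closed_ball_.
- by exists a; rewrite /U /closed_ball_ /= subrr normr0; lra.
move=> x Ux xE; exists x; first exact: Uball.
by apply/eqP; rewrite subr_eq addrC; exact/eqP.
Qed.

Lemma Cks_det m n k (M : 'rV[R]_m -> 'M[R]_n) a :
  (forall i j, Cks k (fun x => M x i j) a) -> Cks k (fun x => \det (M x)) a.
Proof.
move=> CM; apply: Cks_sum => s; apply: CksM; first exact: Cks_cst.
by apply: Cks_prod => i.
Qed.

(** Cramer's rule: near [a] the determinant stays nonzero, and the entries of the inverse are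
    cofactors divided by it. *)
Lemma Cks_invmx m n k (M : 'rV[R]_m -> 'M[R]_n) a i j :
  \det (M a) != 0 -> (forall i j, Cks k (fun x => M x i j) a) ->
  Cks k (fun x => invmx (M x) i j) a.
Proof.
move=> M0 CM; have CD := Cks_det CM.
have D0 := near_neq0 (Cks_cont CD) M0.
have CC : Cks k (fun x => cofactor (M x) j i) a.
  apply: CksM; first exact: Cks_cst.
  apply: Cks_det => u v; apply: (Cks_near _ (CM (lift j u) (lift i v))).
  by apply: near_all => x; rewrite !mxE.
apply: (Cks_near _ (CksM (CksV M0 CD) CC)).
by apply: filterS D0 => x Dx; rewrite /invmx unitmxE unitfE Dx !mxE.
Qed.

Lemma Cks_jacobian m n k (f : 'rV[R]_m -> 'rV[R]_n) a i j :
  Ck k.+1 f a -> Cks k (fun x => jacobian f x i j) a.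
Proof.
move=> [df Df]; have /Ck_coordP/(_ j) := Df (delta_mx 0 i).
apply: Cks_near; apply: filterS df => x dfx.
by rewrite deriveEjacobian// -rowE mxE.
Qed.

(** Put k = g(z) - x and apply the inverse of the Jacobian to f(x + k) = f(x) + df(k) + o(k). The
    Lipschitz bound on [g] turns o(k) into o(z - f(x)). *)
Lemma inverse_differentiable n (f g : 'rV[R]_n -> 'rV[R]_n) (x : 'rV[R]_n) K :
  differentiable f x -> jacobian f x \in unitmx -> g (f x) = x ->
  (\forall z \near f x, f (g z) = z /\ `|g z - x| <= K * `|z - f x|) ->
  is_diff (f x) g (fun v => v *m invmx (jacobian f x)).
Proof.
set J := jacobian f x => df Ju gfx near_g.
pose L : {linear 'rV[R]_n -> 'rV[R]_n} := mulmxr (invmx J).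
have Lc : continuous L by exact: linear_rV_continuous.
have [C C0 LC] := linear_lipschitz Lc.
have gE : g \o shift (f x) = cst (g (f x)) + L +o_ (0 : 'rV[R]_n) id.
  apply/eqaddoP => e e0.
  have /diff_locallyP[_ /eqaddoP fE] := df.
  (* [K] may have any sign; [K'] is positive and bounds it. The precision asked of [f] is then [e]
     divided by [C], which bounds the inverse Jacobian, and by [K']. *)
  pose K' := `|K| + 1; have K0 : 0 < K' by rewrite ltr_wpDl.
  have e'0 : 0 < e / (C * K') by rewrite divr_gt0// mulr_gt0.
  have {}fE := fE _ e'0.
  have shift_near (P : set 'rV[R]_n) : (\forall z \near f x, P z) ->
      \forall h \near (0 : 'rV[R]_n), P (h + f x).
    by rewrite (near_shift 0); apply: filterS => h /=; rewrite subr0.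
  have {}near_g := shift_near _ near_g.
  have KK' (h : 'rV[R]_n) : K * `|h| <= K' * `|h| :> R.
    by rewrite ler_wpM2r// (le_trans (ler_norm K))// lerDl.
  have gc (A : set 'rV[R]_n) : nbhs (0 : 'rV[R]_n) A ->
      \forall h \near (0 : 'rV[R]_n), A (g (h + f x) - x).
    move=> /nbhs_ballP[d /= d0 dA].
    have hd : \forall h \near (0 : 'rV[R]_n), `|h| < d / K'.
      by apply: nbhs0_lt; rewrite divr_gt0.
    apply: (near_imply2 near_g hd) => h [_ gh] {}hd.
    rewrite addrK in gh; apply: dA.
    rewrite -ball_normE /ball_ /= sub0r normrN.
    by rewrite (le_lt_trans gh)// (le_lt_trans (KK' h))// mulrC -ltr_pdivlMr.
  apply: (near_imply2 near_g (gc _ fE)) => h [fgh gh].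
  rewrite addrK in gh.
  rewrite -[X in `|X| <= _ -> _]/(f (g (h + f x) - x + x) -
    (f x + 'd f x (g (h + f x) - x))) subrK fgh.
  rewrite -[X in _ -> `|X| <= _]/(g (h + f x) - (g (f x) + L h)) gfx.
  set k := g (h + f x) - x in gh * => fk.
  (* [L] inverts ['d f x], hence [L ('d f x k) = k]. *)
  have -> : g (h + f x) - (x + L h) = - L (h - 'd f x k).
    have -> : L (h - 'd f x k) = L h - k.
      by rewrite linearB /= -['d f x k]mul_rV_lin1 mulmxK.
    by rewrite opprB opprD addrA addrAC addrC addrA.
  rewrite normrN (le_trans (LC _))//.
  have -> : h - 'd f x k = h + f x - (f x + 'd f x k).
    by rewrite opprD addrA addrK.
  rewrite -ler_pdivlMl// (le_trans fk)//.
  have gK := le_trans gh (KK' h).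
  rewrite (le_trans (ler_wpM2l (ltW e'0) gK))// mulrA /=.
  by rewrite invfM mulrA mulfVK ?gt_eqF// mulrA [_^-1 * e]mulrC.
have dE : 'd g (f x) = L :> (_ -> _) by exact: diff_unique.
by apply: DiffDef => //; apply/diff_locallyP; rewrite dE.
Qed.

(** With [L] the inverse of the Jacobian at [a], the map [h = id - L \o f] has zero derivative at
    [a], so it is a contraction on a small ball; solving [f x = z] amounts to solving
    [x - h x = L z]. Smoothness of the inverse follows by induction from the formula for its
    derivative. *)
Theorem inverse_function n (f : 'rV[R]_n -> 'rV[R]_n) (a : 'rV[R]_n) :
  (\forall x \near a, Cinf f x) -> jacobian f a \in unitmx ->
  exists (W : set 'rV[R]_n) (g : 'rV[R]_n -> 'rV[R]_n),
    [/\ open W, W a,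
        forall O, open O -> O `<=` W -> open (f @` O),
        forall x, W x -> g (f x) = x &
        forall x, W x -> Cinf g (f x)].
Proof.
move=> Cf Ju; set J := jacobian f a in Ju.
have [L LE] : exists L : {linear 'rV[R]_n -> 'rV[R]_n},
    forall v, L v = v *m invmx J by exists (mulmxr (invmx J)).
have Lc : continuous L by exact: linear_rV_continuous.
have [C C0 LC] := linear_lipschitz Lc.
pose h (x : 'rV[R]_n) := x - L (f x).
have dL x : differentiable L x by exact: linear_differentiable.
have diffh x : differentiable f x -> differentiable h x.
  by move=> df; apply: differentiableB => //; exact: differentiable_comp.
have Dh x v : differentiable f x -> 'D_v h x = v - L (v *m jacobian f x).
  move=> df; have dLf : differentiable (L \o f) x by exact: differentiable_comp.
  rewrite -[h]/(id - (L \o f)) deriveB ?derive_id//; last exact: diff_derivable.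
  have dLE y : 'd L y = L :> (_ -> _) by exact: diff_lin.
  suff -> : 'D_v (L \o f) x = L (v *m jacobian f x) by [].
  rewrite (deriveE _ dLf).
  apply: (etrans (congr1 (@^~ v) (diff_comp df (dL _)))).
  apply: (etrans (congr1 (@^~ ('d f x v)) (dLE (f x)))).
  by congr (L _); rewrite mul_rV_lin1.
have Cfa : Cinf f a by exact: nbhs_singleton Cf.
(* With this bound on the partial derivatives, [mean_value_bound] gives the Lipschitz constant 1/2;
   using [n.+1] avoids a zero denominator when [n = 0]. *)
have [c c0 nc] : exists2 c : R, 0 < c & n%:R * c <= 2^-1.
  exists (2^-1 / n.+1%:R); first by rewrite divr_gt0.
  by rewrite mulrCA ler_piMr// ler_pdivrMr// mul1r ler_nat.
have Dhc : \forall x \near a, forall ij : 'I_n * 'I_n,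
    `|('D_(delta_mx 0 ij.2) h x) 0 ij.1| <= c.
  apply: near_forall => -[i j] /=.
  have Ch : Ck 1 h a.
    apply/Ck_coordP => k; have /Ck_coordP Cfk := Cfa 1%N.
    have := CksD (Cks_coord 1 k a) (CksM (Cks_cst 1 (-1) a)
      (Cks_sum (index_enum 'I_n) predT (fun l =>
        CksM (Cfk l) (Cks_cst 1 (invmx J l k) a)))).
    apply: Cks_near; apply: near_all => x.
    by rewrite /h LE !mxE mulN1r.
  have CD : Ck 0 (fun x => 'D_(delta_mx 0 j) h x) a := Ch.2 _.
  have /Ck_coordP/(_ i)/Cks_cont cD := CD.
  have D0 : ('D_(delta_mx 0 j) h a) 0 i = 0.
    have dfa : differentiable f a by exact: nbhs_singleton (Cfa 1%N).1.
    by rewrite Dh// LE mulmxK// subrr mxE.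
  have nc0 : nbhs (('D_(delta_mx 0 j) h a) 0 i) [set y : R | `|y| <= c].
    rewrite D0; apply/nbhs_ballP; exists c => //= y.
    by rewrite -ball_normE /ball_ /= sub0r normrN => /ltW.
  exact: (cD _ nc0).
have det0 : \forall x \near a, \det (jacobian f x) != 0.
  apply: near_neq0; last by rewrite -unitfE -unitmxE.
  apply: (Cks_cont (k := 0) (f := fun x => \det (jacobian f x))).
  apply: (@Cks_det _ _ 0) => i j.
  by apply: Cks_jacobian; exact: Cfa.
have [r r0 ar] : exists2 r : R, 0 < r & forall x : 'rV[R]_n, ball a r x ->
    [/\ Cinf f x, \det (jacobian f x) != 0 &
        forall i j, `|('D_(delta_mx 0 j) h x) 0 i| <= c].
  have [r r0 ar] := (nbhs_ballP _ _).1 (near_and Cf (near_and det0 Dhc)).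
  exists r => // x /ar[/= Cfx [dx Dx]]; split=> // i j.
  exact: (Dx (i, j)).
have df x : ball a r x -> differentiable f x.
  by move=> /ar[/(_ 1%N)[/nbhs_singleton]].
have hlip (x y : 'rV[R]_n) : ball a r x -> ball a r y ->
    `|h x - h y| <= 2^-1 * `|x - y|.
  move=> ax ay; apply: le_trans (mean_value_bound (ltW c0) _ _ ax ay) _.
  - by move=> z /df; exact: diffh.
  - by move=> z i j /ar[_ _]; exact.
  - by rewrite ler_wpM2r.
(* As [L \o f] is the identity minus a map of Lipschitz constant 1/2, it shrinks distances at most
   by a factor 2. This gives injectivity of [f] and the Lipschitz bound for its inverse. *)
have Lf_lip (x y : 'rV[R]_n) : ball a r x -> ball a r y ->
    `|x - y| <= 2 * `|L (f x) - L (f y)|.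
  move=> ax ay; have := hlip _ _ ax ay.
  have -> : h x - h y = (x - y) - (L (f x) - L (f y)).
    by rewrite /h; apply/rowP => k; rewrite !mxE; ring.
  have := ler_distD (L (f x) - L (f y)) (x - y) 0; rewrite !subr0; lra.
have finj (x y : 'rV[R]_n) : ball a r x -> ball a r y -> f x = f y -> x = y.
  move=> ax ay fxy; have := Lf_lip _ _ ax ay.
  by rewrite fxy subrr normr0 mulr0 normr_le0 subr_eq0 => /eqP.
(* The bound r/4 is the range in which [perturbed_identity] finds a solution. It is an open
   condition on the value [f x], so every value near [f x] is again attained in [W]. *)
pose W : set 'rV[R]_n := [set x | ball a r x /\ `|L (f x) - L (f a)| < r / 4].
have near_L x : W x -> \forall z \near f x, `|L z - L (f a)| < r / 4.
  move=> [ax Lx].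
  have : nbhs (f x) (ball (f x) ((r / 4 - `|L (f x) - L (f a)|) / C)).
    by apply: nbhsx_ballx; rewrite divr_gt0// subr_gt0.
  apply: filterS => z; rewrite -ball_normE /ball_ /= => fz.
  rewrite -(subrK (L (f x)) (L z)) -addrA (le_lt_trans (ler_normD _ _))//.
  rewrite -ltrBrDr distrC -linearB (le_lt_trans (LC _))//.
  by rewrite mulrC -ltr_pdivlMr.
have near_surj x : W x -> \forall z \near f x, exists2 y, W y & f y = z.
  move=> [ax Lx].
  apply: filterS (near_L _ (conj ax Lx)) => z Lz.
  have [|y ay yE] := perturbed_identity r0 hlip (y := L z).
    by rewrite /h subKr.
  rewrite /h subKr in yE; exists y; last first.
    by rewrite -[LHS](mulmxKV Ju) -[RHS](mulmxKV Ju) -!LE yE.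
  by split=> //; rewrite yE.
(* The inverse of [f] on [W], with default value [a] off the image. *)
pose g z := xget a [set x | W x /\ f x = z].
have gP x : W x -> g (f x) = x.
  move=> Wx; rewrite /g; case: xgetP => [y _ [Wy fy]|/(_ x)[]//].
  by apply: finj => //; [exact: Wy.1|exact: Wx.1].
have near_g x : W x -> \forall z \near f x, W (g z) /\ f (g z) = z.
  by move=> /near_surj; apply: filterS => z [y Wy <-]; rewrite gP.
have dg x : W x -> is_diff (f x) g (fun v => v *m invmx (jacobian f x)).
  move=> Wx; apply: (@inverse_differentiable _ _ _ _ (2 * C)).
  - by apply: df; exact: Wx.1.
  - by have [_ + _] := ar _ Wx.1; rewrite unitmxE unitfE.
  - exact: gP.
  apply: filterS (near_g _ Wx) => z [Wg fgz]; split=> //.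
  rewrite (le_trans (Lf_lip _ _ Wg.1 Wx.1))// fgz -mulrA ler_pM2l//.
  by rewrite -linearB.
(* Bootstrap over all of [W]: the derivative of [g] at [z] is the inverse Jacobian at [g z], of
   class k as soon as [g] is. *)
have Cg k x : W x -> Ck k g (f x).
  elim: k x => [|k IHk] x Wx.
    apply: filterS (near_g _ Wx) => z [Wg {1}<-].
    by apply: differentiable_continuous; have [] := dg _ Wg.
  split.
    by apply: filterS (near_g _ Wx) => z [Wg <-]; have [] := dg _ Wg.
  move=> v; apply: (@Ck_near _ _ _ _
      (fun z => v *m invmx (jacobian f (g z)))).
    apply: filterS (near_g _ Wx) => z [Wg fgz]; have [dgz dgE] := dg _ Wg.
    by rewrite fgz in dgz dgE; rewrite deriveE// dgE.
  apply/Ck_coordP => i.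
  have [Cfx D0 _] := ar _ Wx.1.
  suff CM j : Cks k (fun z => v 0 j * invmx (jacobian f (g z)) j i) (f x).
    apply: (Cks_near _ (Cks_sum (index_enum 'I_n) predT CM)).
    by apply: near_all => z; rewrite mxE.
  apply: CksM; first exact: Cks_cst.
  apply: Cks_invmx => [|u w]; first by rewrite gP.
  apply: (@Cks_comp _ _ _ _ (fun y => jacobian f y u w)); last exact: IHk.
  by rewrite gP//; apply: Cks_jacobian.
exists W, g; split=> //.
- rewrite openE => x Wx; have [ax Lx] := Wx.
  have cfx : {for x, continuous f} by exact/differentiable_continuous/df.
  have bx : \forall y \near x, ball a r y.
    by apply: open_nbhs_nbhs; split=> //; exact: ball_open.
  apply: filterS2 bx (cfx _ (near_L _ Wx)) => y ay Ly.
  by split.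
- by split; [exact: ballxx|rewrite subrr normr0 divr_gt0].
- move=> O oO OW; rewrite openE => _ [x Ox <-].
  have gx : \forall z \near f x, O (g z).
    apply: (Ck_cont (Cg 0 x (OW _ Ox))); rewrite gP; last exact: OW.
    exact: open_nbhs_nbhs.
  apply: filterS2 (near_g _ (OW _ Ox)) gx => z [_ fgz] Og.
  by exists (g z).
- by move=> x Wx k; exact: Cg.
Qed.

End InverseFunction.

(** * Smooth maps between manifolds *)

Section SmoothCalculus.
Context {R : realType}.
Implicit Types M N X Y Z : manifold R.

Lemma chart_inv_near (T : topologicalType) n (c : chart R T n) x :
  chart_dom c x -> \forall z \near c x,
    chart_dom c (chart_inv c z) /\ c (chart_inv c z) = z.
Proof.
move=> cx; have : nbhs (c x) (c @` chart_dom c).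
  by apply: open_nbhs_nbhs; split; [exact: chart_img_open|exists x].
by apply: filterS => _ [y cy <-]; rewrite chart_mapK.
Qed.

Lemma near_chart (T : topologicalType) n (c : chart R T n) x (P : T -> Prop) :
  chart_dom c x -> (\forall y \near x, P y) ->
  \forall z \near c x, P (chart_inv c z).
Proof.
move=> cx Px; have : nbhs (chart_inv c (c x)) P by rewrite chart_mapK.
exact: (chart_inv_cont cx).
Qed.

Lemma near_dom (T : topologicalType) n (c : chart R T n) x :
  chart_dom c x -> \forall y \near x, chart_dom c y.
Proof.
by move=> cx; apply: open_nbhs_nbhs; split=> //; exact: chart_dom_open.
Qed.

Lemma smooth_at_near M N (f g : M -> N) x :
  (\forall y \near x, f y = g y) -> smooth_at f x -> smooth_at g x.
Proof.
move=> fg [cf Cf]; have fgx := nbhs_singleton fg; split.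
  rewrite /prop_for /continuous_at -fgx.
  by apply: cvg_trans cf; exact: near_eq_cvg.
move=> k; apply: Ck_near (Cf k); rewrite /in_charts -fgx.
have := near_chart (chart_at_dom x) fg.
by apply: filterS => z /= ->.
Qed.

(** Near the point, the new local expression is the old one composed with two transition maps;
    continuity of [f] keeps nearby values in the domain of the chart at [y1]. *)
Lemma change_charts M N (f : M -> N) x (x1 x2 : M) (y1 y2 : N) :
  chart_dom (chart_at x1) x -> chart_dom (chart_at x2) x ->
  chart_dom (chart_at y1) (f x) -> chart_dom (chart_at y2) (f x) ->
  {for x, continuous f} ->
  Cinf (chart_at y1 \o f \o chart_inv (chart_at x1)) (chart_at x1 x) ->
  Cinf (chart_at y2 \o f \o chart_inv (chart_at x2)) (chart_at x2 x).
Proof.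
move=> x1x x2x y1x y2x cf CF k.
have C1 : Ck k (chart_at x1 \o chart_inv (chart_at x2)) (chart_at x2 x).
  exact: chart_at_compat.
have C2 : Ck k (chart_at y2 \o chart_inv (chart_at y1)) (chart_at y1 (f x)).
  exact: chart_at_compat.
have C12 : Ck k (chart_at y1 \o f \o chart_inv (chart_at x1) \o
    (chart_at x1 \o chart_inv (chart_at x2))) (chart_at x2 x).
  by apply: Ck_comp => //=; rewrite chart_mapK//; exact: CF.
have C3 : Ck k ((chart_at y2 \o chart_inv (chart_at y1)) \o
    (chart_at y1 \o f \o chart_inv (chart_at x1) \o
    (chart_at x1 \o chart_inv (chart_at x2)))) (chart_at x2 x).
  by apply: Ck_comp => //=; rewrite !chart_mapK.
apply: Ck_near C3.
have := near_chart x2x (near_and (near_dom x1x)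
  (near_continuous cf (near_dom y1x))).
by apply: filterS => z /= [z1 fz1]; rewrite !chart_mapK.
Qed.

Lemma smooth_at_charts M N (f : M -> N) x (x1 : M) (y1 : N) :
  chart_dom (chart_at x1) x -> chart_dom (chart_at y1) (f x) ->
  {for x, continuous f} ->
  Cinf (chart_at y1 \o f \o chart_inv (chart_at x1)) (chart_at x1 x) ->
  smooth_at f x.
Proof.
move=> x1x y1x cf CF; split=> //.
by apply: change_charts CF => //; exact: chart_at_dom.
Qed.

(** [smooth_at] uses at each point the charts centred there. Here the charts at [x] serve for all
    nearby points, as the inverse function theorem requires. *)
Lemma in_charts_Cinf_near M N (f : M -> N) x :
  (\forall y \near x, smooth_at f y) ->
  \forall z \near chart_at x x, Cinf (in_charts f x) z.
Proof.
move=> sf; have xx := chart_at_dom x; have cf := (nbhs_singleton sf).1.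
have fx := cf _ (near_dom (chart_at_dom (f x))).
have := near_and (chart_inv_near xx) (near_chart xx (near_and sf fx)).
apply: filterS => z [[dz {3}<-] [[cz Cz] /= fz]].
by apply: change_charts Cz => //; exact: chart_at_dom.
Qed.

Lemma in_charts_comp X Y Z (f : X -> Y) (g : Y -> Z) x :
  {for x, continuous f} ->
  \forall z \near chart_at x x,
    (in_charts g (f x) \o in_charts f x) z = in_charts (g \o f) x z.
Proof.
move=> cf.
have := near_chart (chart_at_dom x) (cf _ (near_dom (chart_at_dom (f x)))).
by apply: filterS => z /= fz; rewrite /in_charts /= chart_mapK.
Qed.

Lemma in_charts_at X Y (f : X -> Y) x :
  in_charts f x (chart_at x x) = chart_at (f x) (f x).
Proof. by rewrite /in_charts /= chart_mapK//; exact: chart_at_dom. Qed.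

Lemma smooth_at_comp X Y Z (f : X -> Y) (g : Y -> Z) x :
  smooth_at f x -> smooth_at g (f x) -> smooth_at (g \o f) x.
Proof.
move=> [cf Cf] [cg Cg]; split; first exact: continuous_comp cf cg.
move=> k; apply: Ck_near (in_charts_comp g cf) _.
by apply: Ck_comp; rewrite ?in_charts_at; [exact: Cg|exact: Cf].
Qed.

Lemma smooth_at_differentiable X Y (f : X -> Y) x :
  smooth_at f x -> differentiable (in_charts f x) (chart_at x x).
Proof. by move=> [_ /(_ 1%N)[/nbhs_singleton]]. Qed.

Lemma differentialE X Y (f : X -> Y) x v : smooth_at f x ->
  differential f x v = 'D_v (in_charts f x) (chart_at x x).
Proof.
move=> /smooth_at_differentiable df.
by rewrite /differential lfunE (deriveE _ df).
Qed.

Lemma differential_comp X Y Z (f : X -> Y) (g : Y -> Z) x v :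
  smooth_at f x -> smooth_at g (f x) ->
  differential (g \o f) x v = differential g (f x) (differential f x v).
Proof.
move=> sf sg; have sgf := smooth_at_comp sf sg.
have df := smooth_at_differentiable sf; have dg := smooth_at_differentiable sg.
rewrite (differentialE v sf) (differentialE _ sg) (differentialE v sgf).
rewrite -(near_eq_derive _ (in_charts_comp g sf.1)).
rewrite -(in_charts_at f x) in dg *.
rewrite (deriveE _ df) (deriveE _ dg).
rewrite (deriveE _ (differentiable_comp df dg)).
exact: (congr1 (@^~ v) (diff_comp df dg)).
Qed.

Lemma differential_near X Y (f g : X -> Y) x v :
  (\forall y \near x, f y = g y) -> smooth_at f x ->
  differential f x v = differential g x v.
Proof.
move=> fg sf; have sg := smooth_at_near fg sf.
apply: (etrans (differentialE v sf)).
apply: (etrans _ (esym (differentialE v sg))).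
apply: near_eq_derive; rewrite /in_charts -(nbhs_singleton fg).
have := near_chart (chart_at_dom x) fg.
by apply: filterS => z /= ->.
Qed.

Lemma smooth_at_cst X Y (y : Y) (x : X) : smooth_at (fun=> y) x.
Proof. by split=> [|k]; [exact: cst_continuous|exact: Ck_cst]. Qed.

Lemma differential_cst X Y (y : Y) (x : X) v :
  differential (fun=> y) x v = 0.
Proof.
rewrite (differentialE v (smooth_at_cst y x)).
by rewrite -[in_charts _ _]/(cst (chart_at y y)) derive_cst.
Qed.

Lemma in_charts_id X (x : X) : \forall z \near chart_at x x,
  z = in_charts id x z.
Proof.
by apply: filterS (chart_inv_near (chart_at_dom x)) => z [_ /esym].
Qed.

Lemma smooth_at_id X (x : X) : smooth_at id x.
Proof.
split=> [|k]; first exact: cvg_id.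
by apply: Ck_near (in_charts_id x) _; exact: Ck_id.
Qed.

Lemma differential_id X (x : X) v : differential id x v = v.
Proof.
rewrite (differentialE v (smooth_at_id x)).
by rewrite -(near_eq_derive _ (in_charts_id x)) derive_id.
Qed.

End SmoothCalculus.

(** * Maps into and out of product manifolds *)

Section Products.
Context {R : realType}.
Implicit Types M N X Y Z : manifold R.

Lemma Ck_row_mx m n p k (f : 'rV[R]_m -> 'rV[R]_n)
    (g : 'rV[R]_m -> 'rV[R]_p) a :
  Ck k f a -> Ck k g a -> Ck k (fun x => row_mx (f x) (g x)) a.
Proof.
move=> /Ck_coordP Cf /Ck_coordP Cg; apply/Ck_coordP => i.
rewrite -(splitK i); case: (fintype.split i) => j /=.
  by apply: Cks_near (Cf j); apply: near_all => x; rewrite row_mxEl.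
by apply: Cks_near (Cg j); apply: near_all => x; rewrite row_mxEr.
Qed.

Lemma derive_row_mx m n p (f : 'rV[R]_m -> 'rV[R]_n)
    (g : 'rV[R]_m -> 'rV[R]_p) a v :
  differentiable f a -> differentiable g a ->
  'D_v (fun x => row_mx (f x) (g x)) a = row_mx ('D_v f a) ('D_v g a).
Proof.
move=> df dg.
have dfg : differentiable (fun x => row_mx (f x) (g x)) a.
  apply/differentiable_rowP => i.
  rewrite -(splitK i); case: (fintype.split i) => j /=.
    have -> : (fun y => row_mx (f y) (g y) 0 (lshift p j)) = fun y => f y 0 j.
      by apply/funext => y; rewrite row_mxEl.
    by move/differentiable_rowP : df.
  have -> : (fun y => row_mx (f y) (g y) 0 (rshift n j)) = fun y => g y 0 j.
    by apply/funext => y; rewrite row_mxEr.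
  by move/differentiable_rowP : dg.
apply/rowP => i; rewrite -derive_coord//.
rewrite -(splitK i); case: (fintype.split i) => j /=.
  rewrite row_mxEl -derive_coord//; congr ('D_v _ a).
  by apply/funext => y; rewrite row_mxEl.
rewrite row_mxEr -derive_coord//; congr ('D_v _ a).
by apply/funext => y; rewrite row_mxEr.
Qed.

Lemma smooth_at_pair X M N (f : X -> M) (g : X -> N) x :
  smooth_at f x -> smooth_at g x ->
  smooth_at (fun x => (f x, g x) : prod_manifold M N) x.
Proof.
move=> [cf Cf] [cg Cg]; split; first exact: cvg_pair cf cg.
by move=> k; exact: Ck_row_mx (Cf k) (Cg k).
Qed.

Lemma differential_pair X M N (f : X -> M) (g : X -> N) x v :
  smooth_at f x -> smooth_at g x ->
  differential (fun x => (f x, g x) : prod_manifold M N) x v =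
  row_mx (differential f x v) (differential g x v).
Proof.
move=> sf sg; apply: (etrans (differentialE v (smooth_at_pair sf sg))).
apply: etrans (derive_row_mx v (smooth_at_differentiable sf)
  (smooth_at_differentiable sg)) _.
by congr row_mx; apply/esym/differentialE.
Qed.

Lemma in_charts_fst M N (z : prod_manifold M N) :
  \forall w \near chart_at z z,
    lsubmx w = in_charts (fun z : prod_manifold M N => z.1) z w.
Proof.
have := chart_inv_near (chart_at_dom z).
by apply: filterS => w [_ {1}<-]; rewrite row_mxKl.
Qed.

Lemma in_charts_snd M N (z : prod_manifold M N) :
  \forall w \near chart_at z z,
    rsubmx w = in_charts (fun z : prod_manifold M N => z.2) z w.
Proof.
have := chart_inv_near (chart_at_dom z).
by apply: filterS => w [_ {1}<-]; rewrite row_mxKr.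
Qed.

Lemma smooth_at_fst M N (z : prod_manifold M N) :
  smooth_at (fun z : prod_manifold M N => z.1) z.
Proof.
split=> [|k]; first exact: cvg_fst.
by apply: Ck_near (in_charts_fst z) _; exact: (Ck_linear k lsubmx).
Qed.

Lemma smooth_at_snd M N (z : prod_manifold M N) :
  smooth_at (fun z : prod_manifold M N => z.2) z.
Proof.
split=> [|k]; first exact: cvg_snd.
by apply: Ck_near (in_charts_snd z) _; exact: (Ck_linear k rsubmx).
Qed.

Lemma differential_fst M N (z : prod_manifold M N)
    (v : 'rV[R]_(mdim (prod_manifold M N))) :
  differential (fun z : prod_manifold M N => z.1) z v =
  lsubmx (v : 'rV[R]_(mdim M + mdim N)).
Proof.
apply: (etrans (differentialE v (smooth_at_fst z))).
rewrite -(near_eq_derive _ (in_charts_fst z)).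
rewrite deriveE; last exact: differentiable_lsubmx.
rewrite diff_lin//; exact: linear_rV_continuous.
Qed.

Lemma open_smooth_on M N (S : set M) (f : M -> N) :
  open S -> smooth_on S f <-> (forall x, S x -> smooth_at f x).
Proof.
move=> oS; have nS x : S x -> \forall y \near x, S y.
  by move=> Sx; exact: open_nbhs_nbhs.
split=> [sf x Sx|sf x Sx]; last first.
  by exists f; apply: filterS (nS x Sx) => y Sy; split=> //; exact: sf.
have [g gP] := sf x Sx; apply: (@smooth_at_near _ _ _ g).
  by apply: filterS2 gP (nS x Sx) => y [_ gf] Sy; exact: gf.
exact: (nbhs_singleton gP).1.
Qed.

End Products.

(** * Local bisections through a given arrow *)

Section LocalLift.
Context {R : realType}.

(** The integers from 0 to [size p - 1] are distinct in [R], too many to be all roots of [p]. *)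
Lemma poly_nonroot (p : {poly R}) : p != 0 -> exists c, p.[c] != 0.
Proof.
move=> p0; pose s := [seq i%:R : R | i <- iota 0 (size p)].
have us : uniq s.
  by rewrite map_inj_uniq ?iota_uniq// => i j /eqP; rewrite eqr_nat => /eqP.
have /allPn[c _ pc] : ~~ all (root p) s.
  apply/negP => ps; have := max_poly_roots p0 ps us.
  by rewrite size_map size_iota ltnn.
by exists c.
Qed.

(* Take L = S' + c T' with S' S = 1 = T' T: det (L S) and det (L T) are
   polynomials in c, the first with value 1 at c = 0, the second monic. *)
Lemma common_section m n (S T : 'M[R]_(m, n)) :
  row_full S -> row_full T ->
  exists L : 'M[R]_(n, m), L *m S \in unitmx /\ L *m T \in unitmx.
Proof.
move=> /row_fullP[S' S'S] /row_fullP[T' T'T].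
pose p := char_poly (- (S' *m T)).
pose q := \det (1%:M + 'X *: map_mx polyC (T' *m S)).
have q0 : q != 0.
  suff : q.[0] != 0 by apply: contra_neq => ->; rewrite horner0.
  rewrite -horner_evalE -det_map_mx map_mxD map_mx1 map_mxZ /=.
  rewrite horner_evalE hornerX.
  by rewrite scale0r addr0 det1 oner_neq0.
have p0 : p != 0 by exact: monic_neq0 (char_poly_monic _).
have [c] := poly_nonroot (mulf_neq0 p0 q0).
rewrite hornerM mulf_eq0 negb_or => /andP[pc qc].
exists (S' + c *: T').
split; rewrite unitmxE unitfE mulmxDl -scalemxAl ?S'S ?T'T.
  move: qc; rewrite -horner_evalE -det_map_mx map_mxD map_mx1 map_mxZ /=.
  rewrite horner_evalE hornerX.
  congr (\det (_ + c *: _) != 0).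
  by apply/matrixP => i j; rewrite !mxE horner_evalE hornerC.
move: pc; rewrite /p /char_poly -horner_evalE -det_map_mx.
congr (\det _ != 0); apply/matrixP => i j.
rewrite !mxE /= horner_evalE hornerD hornerN hornerC opprK addrC.
by rewrite hornerMn hornerX mulr_natr.
Qed.

Lemma limg_row_full m n (f : 'Hom('rV[R]_m, 'rV[R]_n)) :
  limg f = fullv -> row_full (lin1_mx f).
Proof.
move=> ff; apply/row_fullP.
have fw (w : 'rV[R]_n) : exists v, f v == w.
  have := memvf w; rewrite -ff => /memv_imgP[v _ ->]; by exists v.
exists (\matrix_i xchoose (fw (row i 1%:M))).
apply/row_matrixP => i; rewrite row_mul rowK mul_rV_lin1.
by apply/eqP; exact: (xchooseP (fw _)).
Qed.

Lemma derive_affine m n (A : 'M[R]_(m, n)) (w : 'rV[R]_n) a v :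
  'D_v (fun x => w + x *m A) a = v *m A.
Proof.
have -> : (fun x => w + x *m A) = cst w + mulmxr A by [].
have dA : differentiable (mulmxr A) a.
  by apply: linear_differentiable; exact: linear_rV_continuous.
rewrite deriveD//; last exact: diff_derivable.
rewrite derive_cst add0r deriveE// diff_lin//; exact: linear_rV_continuous.
Qed.

Lemma open_chart_preim (T : topologicalType) n (c : chart R T n) O :
  open O -> open (chart_dom c `&` c @^-1` O).
Proof.
move=> oO; rewrite openE => x [cx Ox].
have : \forall y \near x, O (c y).
  by apply: (chart_map_cont cx); exact: open_nbhs_nbhs.
by apply: filterS2 (near_dom cx) => y.
Qed.

(** The map [sigma] parametrizes the affine slice through [x] in the directions of [L]. The
    hypothesis makes [f \o sigma] locally invertible at 0, and [tau] is the resulting local section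
    of [f] with values in the slice. *)
Lemma local_lift (M N : manifold R) (f : M -> N) (x : M)
    (L : 'M[R]_(mdim N, mdim M)) :
  smooth f -> L *m lin1_mx (differential f x) \in unitmx ->
  let sigma u := chart_inv (chart_at x) (chart_at x x + u *m L) in
  exists (W : set 'rV[R]_(mdim N)) (tau : N -> M),
    [/\ open W, W 0,
        forall O, open O -> O `<=` W -> open [set f (sigma u) | u in O] &
        forall u, W u -> tau (f (sigma u)) = sigma u /\
          smooth_at tau (f (sigma u))].
Proof.
move=> sf Lu sigma; pose c := chart_at (f x); have xx := chart_at_dom x.
pose aff (u : 'rV[R]_(mdim N)) := chart_at x x + u *m L.
have Caff k u : Ck k aff u.
  have := Ck_affine k L 0 (chart_at x x) u.
  by apply: Ck_near; apply: near_all => v; rewrite subr0.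
have aff0 : aff 0 = chart_at x x by rewrite /aff mul0mx addr0.
pose F := in_charts f x \o aff.
have near_aff (P : 'rV[R]_(mdim M) -> Prop) :
    (\forall z \near chart_at x x, P z) ->
    \forall u \near (0 : 'rV[R]_(mdim N)), P (aff u).
  by rewrite -aff0; exact: (Ck_cont (Caff 0%N 0)).
have CF : \forall u \near (0 : 'rV[R]_(mdim N)), Cinf F u.
  have := near_aff _ (in_charts_Cinf_near (near_all x sf)).
  by apply: filterS => u Cu k; exact: Ck_comp.
have JF : jacobian F 0 \in unitmx.
  have dfx := smooth_at_differentiable (sf x).
  suff -> : jacobian F 0 = L *m lin1_mx (differential f x) by [].
  have daff : differentiable aff 0 by exact: nbhs_singleton (Caff 1%N 0).1.
  apply/row_matrixP => i; rewrite !rowE mulmxA [RHS]mul_rV_lin1.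
  apply: (etrans _ (esym (differentialE _ (sf x)))).
  rewrite -aff0 in dfx *; have dF := differentiable_comp daff dfx.
  rewrite -deriveEjacobian// (deriveE _ dF).
  apply: (etrans (congr1 (@^~ _) (diff_comp daff dfx))).
  rewrite (deriveE _ dfx) /=; congr ('d (in_charts f x) (aff 0) _).
  by rewrite -(deriveE _ daff); exact: derive_affine.
have [W1 [Phi [oW1 W10 W1open PhiK CPhi]]] := inverse_function CF JF.
pose good (u : 'rV[R]_(mdim N)) :=
  (chart_dom (chart_at x) (sigma u) /\ chart_at x (sigma u) = aff u) /\
  chart_dom c (f (sigma u)).
have good0 : \forall u \near (0 : 'rV[R]_(mdim N)), good u.
  have nf := (sf x).1 _ (near_dom (chart_at_dom (f x))).
  apply: (near_imply2 (near_aff _ (chart_inv_near xx))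
    (near_aff _ (near_chart xx nf))) => u [du su] fu.
  by split.
pose W := W1 `&` [set u | good u]^°.
have WW1 : W `<=` W1 by move=> u [].
have Wgood u : W u -> good u by move=> [_ /interior_subset].
have oW : open W by apply: openI => //; exact: open_interior.
(* Read [y] in the chart at [f x], recover the parameter by [Phi], and return to the slice. *)
pose tau y := sigma (Phi (c y)).
have tauK u : W u -> tau (f (sigma u)) = sigma u.
  by move=> Wu; congr sigma; apply: PhiK; exact: WW1.
exists W, tau; split=> //.
- move=> O oO OW; have OW1 := subset_trans OW WW1.
  suff -> : [set f (sigma u) | u in O] = chart_dom c `&` c @^-1` (F @` O).
    by apply: open_chart_preim; exact: W1open.
  apply/seteqP; split=> [_ [u Ou <-]|y [cy [u Ou Fu]]].
    by split; [exact: (Wgood _ (OW _ Ou)).2|exists u].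
  exists u => //; rewrite -[RHS](chart_mapK cy) -Fu /F /in_charts /=.
  by rewrite (chart_mapK (Wgood _ (OW _ Ou)).2).
move=> u Wu; split; first exact: tauK.
have [[du su] cu] := Wgood _ Wu.
have cF : c (f (sigma u)) = F u by [].
have cPhi : {for F u, continuous Phi} by exact: Ck_cont (CPhi _ (WW1 _ Wu) 0%N).
have ctau : {for f (sigma u), continuous tau}.
  apply: (@continuous_comp _ _ _ c
    (fun z => chart_inv (chart_at x) (aff (Phi z)))).
    exact: chart_map_cont.
  apply: (@continuous_comp _ _ _ Phi
    (fun z => chart_inv (chart_at x) (aff z))) => //.
  apply: (@continuous_comp _ _ _ aff (chart_inv (chart_at x))).
    exact: Ck_cont (Caff 0%N _).
  rewrite cF (PhiK _ (WW1 _ Wu)) -su; exact: chart_inv_cont.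
apply: (@smooth_at_charts _ _ _ _ _ (f x) x) => //; first by rewrite tauK.
move=> k; rewrite -/c cF.
have FW : \forall z \near F u, (F @` W) z.
  apply: open_nbhs_nbhs; split; first exact: W1open.
  by exists u.
(* In charts [tau] is [aff \o Phi], since the points near [F u] are values of [F] on [W]. *)
apply: (@Ck_near _ _ _ _ (aff \o Phi)).
  apply: (near_imply2 FW (chart_inv_near cu)) => _ [w Ww <-] [_ cw].
  rewrite /tau /= /c cw (PhiK _ (WW1 _ Ww)).
  by have [[_ ->]] := Wgood _ Ww.
by apply: Ck_comp; [exact: Caff|exact: CPhi (WW1 _ Wu) k].
Qed.

End LocalLift.

Section Bisections.
Context {R : realType} {G0 G : manifold R} (Gr : lie_groupoid G0 G).

(** A slice through [g] along a common complement of the kernels of ds and dt is transverse to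
    source and target fibres at once. The lift [taus] of the source into this slice is the
    bisection. *)
Lemma exists_local_bisection (g : G) : exists U gamma,
  [/\ local_bisection Gr U gamma, U (src Gr g) & gamma (src Gr g) = g].
Proof.
have [ss ds] := src_submersion Gr; have [st dt] := tgt_submersion Gr.
have [L [Ls Lt]] :=
  common_section (limg_row_full (ds g)) (limg_row_full (dt g)).
pose sigma (u : 'rV[R]_(mdim G0)) : G :=
  chart_inv (chart_at g) (chart_at g g + u *m L).
have [Ws [taus [oWs Ws0 Wsopen]]] := local_lift ss Ls.
move=> tausK.
have {tausK}tausP u : Ws u -> taus (src Gr (sigma u)) = sigma u /\
    smooth_at taus (src Gr (sigma u)) by exact: tausK.
have [Wt [taut [oWt Wt0 Wtopen]]] := local_lift st Lt.
move=> tautK.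
have {tautK}tautP u : Wt u -> taut (tgt Gr (sigma u)) = sigma u /\
    smooth_at taut (tgt Gr (sigma u)) by exact: tautK.
have sigma0 : sigma 0 = g.
  by rewrite /sigma mul0mx addr0 chart_mapK//; exact: chart_at_dom.
pose W := Ws `&` Wt.
have oW : open W by exact: openI.
have W0 : W 0 by [].
have WsW : W `<=` Ws by move=> u [].
have WtW : W `<=` Wt by move=> u [].
pose U := [set src Gr (sigma u) | u in W].
have oU : open U by exact: Wsopen.
have staus x : U x -> smooth_at taus x.
  by move=> [u /WsW Wu <-]; have [] := tausP _ Wu.
have VE : (tgt Gr \o taus) @` U = [set tgt Gr (sigma u) | u in W].
  apply/seteqP; split=> [_ [_ [u Wu <-] <-]|_ [u Wu <-]].
    by exists u => //=; have [-> _] := tausP _ (WsW _ Wu).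
  exists (src Gr (sigma u)); first by exists u.
  by rewrite /=; have [-> _] := tausP _ (WsW _ Wu).
have oV : open ((tgt Gr \o taus) @` U) by rewrite VE; exact: Wtopen.
exists U, taus; split; [|by exists 0; rewrite ?sigma0|]; last first.
  by have [+ _] := tausP _ Ws0; rewrite sigma0.
split=> //.
- by apply/(open_smooth_on _ oU).
- by move=> _ [u Wu <-]; have [-> _] := tausP _ (WsW _ Wu).
(* The inverse of [tgt Gr \o taus] lifts a target to the slice by [taut] and then takes its
   source. *)
exists (src Gr \o taut); split.
- apply/(open_smooth_on _ oU) => x Ux.
  by apply: smooth_at_comp; [exact: staus|exact: st].
- apply/(open_smooth_on _ oV) => y; rewrite VE => -[u Wu <-].
  by apply: smooth_at_comp; [have [] := tautP _ (WtW _ Wu)|exact: ss].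
- move=> x Ux; split; first by exists x.
  have [u Wu <-] := Ux; rewrite /=.
  by have [-> _] := tausP _ (WsW _ Wu); have [-> _] := tautP _ (WtW _ Wu).
move=> y; rewrite VE => -[u Wu <-] /=; have [-> _] := tautP _ (WtW _ Wu).
by split; [exists u|have [-> _] := tausP _ (WsW _ Wu)].
Qed.

End Bisections.

(** * Connections on principal bundles *)

Section Extensions.
Context {R : realType}.
Implicit Types M N X Y Z : manifold R.

Lemma local_extension_xget X Y (S : set X) (f : X -> Y) x :
  smooth_on S f -> S x ->
  local_extension S f x (xget f (local_extension S f x)).
Proof. by move=> sf Sx; have [g gP] := sf x Sx; exact: (xgetI f gP). Qed.

(** Form of the chain rule for differentiating an identity known only near [x]. The tangent vectors
    at [y] are written in a chart depending on [y], so the equation [f x = y] is a separate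
    hypothesis that allows a simplified base point. *)
Lemma differential_chain X Y Z (f : X -> Y) (g : Y -> Z) (h : X -> Z) x y v :
  f x = y -> smooth_at f x -> smooth_at g y ->
  (\forall z \near x, g (f z) = h z) ->
  differential g y (differential f x v) = differential h x v.
Proof.
move=> <- sf sg gfh; apply: etrans (esym (differential_comp v sf sg)) _.
by apply: differential_near => //; exact: smooth_at_comp.
Qed.

Lemma differential_chain2 X M N Z (f : X -> M) (g : X -> N)
    (m : prod_manifold M N -> Z) (h : X -> Z) x y1 y2 v :
  f x = y1 -> g x = y2 ->
  smooth_at f x -> smooth_at g x -> smooth_at m (y1, y2) ->
  (\forall z \near x, m (f z, g z) = h z) ->
  differential m (y1, y2) (row_mx (differential f x v) (differential g x v)) =
  differential h x v.
Proof.
move=> <- <- sf sg sm mh.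
have <- := differential_pair v sf sg.
exact: (differential_chain v erefl (smooth_at_pair sf sg) sm mh).
Qed.

Lemma near_smooth_pair X M N (f : X -> M) (g : X -> N) x
    (P : prod_manifold M N -> Prop) :
  smooth_at f x -> smooth_at g x ->
  (\forall z \near ((f x, g x) : prod_manifold M N), P z) ->
  \forall y \near x, P (f y, g y).
Proof.
move=> sf sg; exact: (near_continuous (smooth_at_pair sf sg).1).
Qed.

End Extensions.

(** * Smoothness of groupoid operations *)

Section Groupoid.
Context {R : realType} {G0 G : manifold R} (Gr : lie_groupoid G0 G).

Lemma ginvK g : ginv Gr (ginv Gr g) = g.
Proof.
have t2 : tgt Gr (ginv Gr (ginv Gr g)) = tgt Gr g by rewrite tgt_ginv src_ginv.
have := gmulA (tgt_ginv Gr (ginv Gr g)) (tgt_ginv Gr g).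
by rewrite !ginv_gmul -t2 gmul_unt tgt_ginv unt_gmul.
Qed.

(** The pair of maps stays in the fibre product near [x], where the multiplication coincides with a
    smooth local extension. *)
Lemma smooth_at_gmul (X : manifold R) (f h : X -> G) (x : X) :
  smooth_at f x -> smooth_at h x ->
  (\forall y \near x, tgt Gr (f y) = src Gr (h y)) ->
  smooth_at (fun y => gmul Gr (f y) (h y)) x.
Proof.
move=> sf sh fh.
have fhx : fiber_prod (tgt Gr) (src Gr) (f x, h x) := nbhs_singleton fh.
have [m mP] := gmul_smooth fhx.
have sm := smooth_at_comp (smooth_at_pair sf sh) (nbhs_singleton mP).1.
apply: smooth_at_near sm.
have := near_smooth_pair sf sh mP.
by apply: filterS2 fh => y fhy [_ /(_ fhy)].
Qed.

Lemma smooth_at_conj (gamma : G0 -> G) x :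
  (\forall y \near x, smooth_at gamma y /\ src Gr (gamma y) = y) ->
  smooth_at (conj_bisection Gr gamma) (unt Gr x).
Proof.
move=> gP; have [ss _] := src_submersion Gr; have [st _] := tgt_submersion Gr.
have srcP : \forall g \near unt Gr x, src Gr (gamma (src Gr g)) = src Gr g.
  have : \forall y \near src Gr (unt Gr x),
      smooth_at gamma y /\ src Gr (gamma y) = y.
    by rewrite src_unt.
  by move=> /(near_continuous (ss _).1); apply: filterS => g [].
have tgtP : \forall g \near unt Gr x, src Gr (gamma (tgt Gr g)) = tgt Gr g.
  have : \forall y \near tgt Gr (unt Gr x),
      smooth_at gamma y /\ src Gr (gamma y) = y.
    by rewrite tgt_unt.
  by move=> /(near_continuous (st _).1); apply: filterS => g [].
have sg := (nbhs_singleton gP).1.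
have s1 : smooth_at (ginv Gr \o (gamma \o src Gr)) (unt Gr x).
  apply: smooth_at_comp; last exact: ginv_smooth.
  by apply: smooth_at_comp; [exact: ss|rewrite src_unt].
have s2 : smooth_at (gamma \o tgt Gr) (unt Gr x).
  by apply: smooth_at_comp; [exact: st|rewrite tgt_unt].
apply: (smooth_at_gmul
  (f := fun g => gmul Gr (ginv Gr (gamma (src Gr g))) g)) => //.
  apply: (smooth_at_gmul (f := ginv Gr \o (gamma \o src Gr)) (h := id)) => //.
    exact: smooth_at_id.
  by apply: filterS srcP => g /= sgE; rewrite tgt_ginv sgE.
by apply: filterS2 srcP tgtP => g sgE tgE; rewrite tgt_gmul ?tgt_ginv ?sgE ?tgE.
Qed.

Lemma local_bisection_near U gamma x : local_bisection Gr U gamma -> U x ->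
  \forall y \near x, smooth_at gamma y /\ src Gr (gamma y) = y.
Proof.
move=> [oU sg sgE _ _] Ux.
have : \forall y \near x, U y by exact: open_nbhs_nbhs.
apply: filterS => y Uy.
by split; [exact/(open_smooth_on gamma oU).1|exact: sgE].
Qed.

End Groupoid.

(** * The division map and its differential *)

Section PrincipalBundle.
Context {R : realType} {G0 G : manifold R} {Gr : lie_groupoid G0 G}.
Context {M P : manifold R} (B : principal_bundle Gr M P).

Notation pi := (Defs.proj B).
Notation eps := (moment B).

(** The fibre is the slice over [pi p] in a local trivialization [psi]. As [psi] lies over the base,
    its differential sends a vertical vector to one with zero base component, whose fibre component
    is the required [w]. *)
Lemma fiber_parametrization p : exists (F : manifold R) (j : F -> P) (f0 : F),
  [/\ smooth j, j f0 = p, forall f, pi (j f) = pi p &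
      forall v, v \in vertical B p -> exists w, differential j f0 w = v].
Proof.
have [U [F [psi [oU Up [phi [spsi sphi psiK phiK]] psi1]]]] :=
  proj_locally_trivial B (pi p).
have oV : open [set z : prod_manifold M F | U z.1].
  by apply: open_comp oU => z _; exact: cvg_fst.
have oS : open (pi @^-1` U).
  by apply: open_comp oU => z _; exact: (proj_smooth B z).1.
pose j (f : F) : P := phi (pi p, f).
have psip : psi p = (pi p, (psi p).2).
  by rewrite -(psi1 _ Up) -surjective_pairing.
have sphij f : smooth_at phi (pi p, f) by exact/(open_smooth_on phi oV).1.
have spair f : smooth_at (fun f : F => (pi p, f) : prod_manifold M F) f.
  by apply: smooth_at_pair; [exact: smooth_at_cst|exact: smooth_at_id].
have spsip : smooth_at psi p by exact/(open_smooth_on psi oS).1.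
have nS : \forall q \near p, U (pi q) by exact: open_nbhs_nbhs.
exists F, j, (psi p).2; split.
- by move=> f; exact: (smooth_at_comp (spair f) (sphij f)).
- by rewrite /j -psip; have [] := psiK p Up.
- move=> f; have [Uf phif] := phiK (pi p, f) Up.
  by rewrite -(psi1 _ Uf) phif.
move=> v; rewrite memv_ker => /eqP v0.
pose w := differential psi p v : 'rV[R]_(mdim M + mdim F).
have w1 : lsubmx w = 0.
  rewrite -v0 -(differential_fst (psi p)).
  apply: (differential_chain v erefl spsip (smooth_at_fst _)).
  by apply: filterS nS => q /psi1.
exists (rsubmx w).
have <- := differential_chain2 (rsubmx w) (erefl (pi p)) (erefl (psi p).2)
  (smooth_at_cst _ _) (smooth_at_id _) (sphij _) (near_all _ (fun=> erefl)).
rewrite differential_cst differential_id -w1 hsubmxK -psip.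
rewrite -[RHS](differential_id p).
apply: (differential_chain v erefl spsip); first by rewrite psip.
by apply: filterS nS => q /psiK[].
Qed.

(** The shear map is injective, so the arrow from [p] to a given point is unique; its surjectivity
    gives existence in [divisionP]. *)
Lemma division_act p g : eps p = src Gr g -> division B p (act B p g) = g.
Proof.
move=> pg; have [sh [_ _ shK _]] := shear_diffeo B.
rewrite /division; case: xgetP => [k _ [pk kg]|/(_ g)[]//].
have [_ e1] := shK (p, k) pk; have [_ e2] := shK (p, g) pg.
by rewrite /= kg in e1; rewrite /= e1 in e2; case: e2.
Qed.

Lemma divisionP p q : pi q = pi p ->
  eps p = src Gr (division B p q) /\ act B p (division B p q) = q.
Proof.
move=> pq; have [sh [_ _ _ shP]] := shear_diffeo B.
have [shS /= shE] := shP (p, q) (esym pq).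
have [e1 e2] : (sh (p, q)).1 = p /\ act B (sh (p, q)).1 (sh (p, q)).2 = q.
  by case: shE.
rewrite /fiber_prod /= e1 in shS e2.
by move: (sh (p, q)).2 shS e2 => k pk <-; rewrite division_act.
Qed.

(** The division map is the second component of the inverse shear map, precomposed with
    [q |-> (p, q)]; a local extension of that inverse supplies the one needed here. *)
Lemma division_smooth p : smooth_on [set q | pi q = pi p] (division B p).
Proof.
have [sh [_ ssh _ shP]] := shear_diffeo B.
move=> q0 /= q0p; have [m mP] := ssh (p, q0) (esym q0p).
pose i (q : P) := (p, q) : prod_manifold P P.
have si q : smooth_at i q.
  by apply: smooth_at_pair; [exact: smooth_at_cst|exact: smooth_at_id].
exists ((fun z : prod_manifold P G => z.2) \o (m \o i)).
have := near_continuous (si q0).1 mP; apply: filterS => q [smq mq]; split.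
  apply: smooth_at_comp; last exact: smooth_at_snd.
  exact: smooth_at_comp.
move=> /= qp; rewrite mq//.
have [shS /= shE] := shP (p, q) (esym qp).
have [e1 e2] : (sh (p, q)).1 = p /\ act B (sh (p, q)).1 (sh (p, q)).2 = q.
  by case: shE.
rewrite /fiber_prod /= e1 in shS e2.
by rewrite /i; move: (sh (p, q)).2 shS e2 => k pk <-; rewrite division_act.
Qed.

(* The local extension of division p that connection_form differentiates. *)
Let D p := xget (division B p)
  (local_extension [set q | pi q = pi p] (division B p) p).

Lemma divisionxx p : division B p p = unt Gr (eps p).
Proof. by rewrite -{2}(act_unt B p) division_act// src_unt. Qed.

Let DP p : \forall q \near p,
  smooth_at (D p) q /\ (pi q = pi p -> D p q = division B p q).
Proof. by apply: local_extension_xget; first exact: division_smooth. Qed.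

Let Dp p : D p p = unt Gr (eps p).
Proof. by rewrite (nbhs_singleton (DP p)).2// divisionxx. Qed.

(** [D p] is tied to the division map only on the fibre and near [p], which is where [j] takes its
    values near [f0]. *)
Let Dj p (F : manifold R) (j : F -> P) (f0 : F) : smooth_at j f0 -> j f0 = p ->
  (forall f, pi (j f) = pi p) ->
  \forall f \near f0, D p (j f) = division B p (j f).
Proof.
move=> sj jf0 pj; have : \forall q \near j f0,
    smooth_at (D p) q /\ (pi q = pi p -> D p q = division B p q).
  by rewrite jf0; exact: DP.
by move=> /(near_continuous sj.1); apply: filterS => f [_]; apply.
Qed.

Lemma anchor_division p v : v \in vertical B p ->
  anchor Gr (eps p) (differential (D p) p v) = differential eps p v.
Proof.
have [F [j [f0 [sj jf0 pj jv]]]] := fiber_parametrization p.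
move=> /jv[w <-]; have sD := (nbhs_singleton (DP p)).1.
have [st _] := tgt_submersion Gr.
have seps := moment_smooth B.
have sDj : smooth_at (D p \o j) f0 by apply: smooth_at_comp; rewrite ?jf0.
have -> := differential_chain w jf0 (sj f0) (seps _) (near_all _ (fun=> erefl)).
have -> := differential_chain w jf0 (sj f0) sD (near_all _ (fun=> erefl)).
apply: (differential_chain w _ sDj (st _)); first by rewrite /= jf0 Dp.
apply: filterS (Dj (sj f0) jf0 pj) => f /= ->.
have [e1 e2] := divisionP (pj f).
by rewrite -(moment_act e1) e2.
Qed.

Lemma division_inj p v :
  v \in vertical B p -> differential (D p) p v = 0 -> v = 0.
Proof.
have [F [j [f0 [sj jf0 pj jv]]]] := fiber_parametrization p.
move=> /jv[w <-] Dv; have sD := (nbhs_singleton (DP p)).1.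
have pu : fiber_prod eps (src Gr) (p, unt Gr (eps p)).
  by rewrite /fiber_prod /= src_unt.
have [m mP] := act_smooth pu.
have sDj : smooth_at (D p \o j) f0 by apply: smooth_at_comp; rewrite ?jf0.
have scp : smooth_at (fun _ : F => p) f0 by exact: smooth_at_cst.
have Djf0 : (D p \o j) f0 = unt Gr (eps p) by rewrite /= jf0 Dp.
(* This is p . delta(p, q) = q along the parametrized fibre, with the action replaced by its
   extension [m]. Its first factor is constant, so a vanishing differential of [D p] forces the
   vector to vanish. *)
have nm : \forall f \near f0, m (p, (D p \o j) f) = j f.
  have := mP; rewrite -Djf0 => /(near_smooth_pair scp sDj).
  apply: filterS2 (Dj (sj f0) jf0 pj) => f /= -> [_ mf].
  by have [e1 e2] := divisionP (pj f); rewrite mf.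
have <- := differential_chain2 w erefl Djf0 scp sDj (nbhs_singleton mP).1 nm.
have <- := differential_chain w jf0 (sj f0) sD (near_all _ (fun=> erefl)).
by rewrite Dv differential_cst row_mx0 linear0.
Qed.

(** * The action of a bisection on the bundle *)

Section ActBisection.
Variables (gamma : G0 -> G) (p : P).
Hypothesis gammaP : \forall y \near eps p,
  smooth_at gamma y /\ src Gr (gamma y) = y.

Let gamma_eps : \forall q \near p, eps q = src Gr (gamma (eps q)).
Proof.
have := near_continuous (moment_smooth B p).1 gammaP.
by apply: filterS => q [].
Qed.

Let smooth_gamma_eps : smooth_at (gamma \o eps) p.
Proof.
apply: smooth_at_comp; first exact: moment_smooth.
exact: (nbhs_singleton gammaP).1.
Qed.

(** R_gamma is the action composed with [q |-> (q, gamma (eps q))]; when d eps(v) = 0 the second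
    component of the differential vanishes, leaving the action's differential on (v, 0). *)
Lemma act_bisection_right_transl : smooth_at (act_bisection B gamma) p /\
  forall v, differential eps p v = 0 ->
    differential (act_bisection B gamma) p v =
    right_transl B p (gamma (eps p)) v.
Proof.
have pg : fiber_prod eps (src Gr) (p, gamma (eps p)).
  exact: nbhs_singleton gamma_eps.
have := local_extension_xget (@act_smooth _ _ _ _ _ _ B) pg.
rewrite /right_transl /differential_on; set m := xget _ _ => mP.
have sid := smooth_at_id p.
have sm := (nbhs_singleton mP).1.
have nm : \forall q \near p, m (q, (gamma \o eps) q) = act_bisection B gamma q.
  have := near_smooth_pair sid smooth_gamma_eps mP.
  by apply: filterS2 gamma_eps => q qg [_ ->].
split.
  apply: (smooth_at_near nm).
  exact: (smooth_at_comp (smooth_at_pair sid smooth_gamma_eps) sm).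
move=> v v0.
have <- := differential_chain2 v erefl erefl sid smooth_gamma_eps sm nm.
rewrite differential_id.
have <- := differential_chain v erefl (moment_smooth B p)
  (nbhs_singleton gammaP).1 (near_all _ (fun=> erefl)).
by rewrite v0 linear0.
Qed.

(** R_gamma preserves the fibres of the projection; consequently its differential maps vertical
    vectors to vertical vectors. *)
Lemma proj_act_bisection v :
  differential pi (act_bisection B gamma p)
    (differential (act_bisection B gamma) p v) = differential pi p v.
Proof.
have [sR _] := act_bisection_right_transl.
apply: (differential_chain v erefl sR (proj_smooth B _)).
by apply: filterS gamma_eps => q qg; rewrite /act_bisection proj_act.
Qed.

(* Conjugation by gamma is the coordinate expression of R_gamma in the division
   charts at p and at R_gamma p. *)
Lemma Ad_division v : v \in vertical B p ->
  differential (D (act_bisection B gamma p)) (act_bisection B gamma p)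
    (differential (act_bisection B gamma) p v) =
  Ad_inv Gr gamma (eps p) (differential (D p) p v).
Proof.
have [F [j [f0 [sj jf0 pj jv]]]] := fiber_parametrization p.
move=> /jv[w <-]; have [sR _] := act_bisection_right_transl.
set R_ := act_bisection B gamma in sR *.
have sDj : smooth_at (D p \o j) f0.
  by apply: smooth_at_comp; rewrite ?jf0//; exact: (nbhs_singleton (DP p)).1.
have sRj0 : smooth_at R_ (j f0) by rewrite jf0.
have sRj := smooth_at_comp (sj f0) sRj0.
have E1 := differential_chain w jf0 (sj f0) (nbhs_singleton (DP p)).1
  (near_all _ (fun=> erefl)).
have E2 := differential_chain w jf0 (sj f0) sR (near_all _ (fun=> erefl)).
have sconj := smooth_at_conj gammaP.
have Djf0 : D p (j f0) = unt Gr (eps p) by rewrite jf0 Dp.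
have E3 := differential_chain w Djf0 sDj sconj (near_all _ (fun=> erefl)).
apply: etrans (congr1 (fun u => differential _ _ u) E2) _.
have E13 := etrans (congr1 (fun u => Ad_inv Gr gamma (eps p) u) E1) E3.
apply: etrans _ (esym E13).
apply: (differential_chain w _ sRj (nbhs_singleton (DP (R_ p))).1).
  by rewrite /= jf0.
have nj : \forall q \near j f0, eps q = src Gr (gamma (eps q)).
  by rewrite jf0.
have nD : \forall f \near f0, pi (R_ (j f)) = pi (R_ p) ->
    D (R_ p) (R_ (j f)) = division B (R_ p) (R_ (j f)).
  have nDR : \forall q \near (R_ \o j) f0, smooth_at (D (R_ p)) q /\
      (pi q = pi (R_ p) -> D (R_ p) q = division B (R_ p) q).
    by rewrite /= jf0; exact: DP.
  by have := near_continuous sRj.1 nDR; apply: filterS => f [].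
have pg := nbhs_singleton gamma_eps.
have := near_and (near_continuous (sj f0).1 nj) nD.
apply: filterS2 (Dj (sj f0) jf0 pj) => f DE [jg DR].
rewrite -[LHS]/(D (R_ p) (R_ (j f))).
rewrite -[RHS]/(conj_bisection Gr gamma (D p (j f))) DE.
have [e1 e2] := divisionP (pj f); set d := division B p (j f) in e1 e2 *.
rewrite DR; last by rewrite /R_ /act_bisection !proj_act.
have dt : tgt Gr d = eps (j f) by rewrite -(moment_act e1) e2.
have c1 : tgt Gr (gamma (eps p)) = src Gr (ginv Gr (gamma (eps p))).
  by rewrite src_ginv.
have c2 : tgt Gr (ginv Gr (gamma (eps p))) = src Gr d by rewrite tgt_ginv -pg.
have c3 : tgt Gr (gmul Gr (ginv Gr (gamma (eps p))) d) =
    src Gr (gamma (eps (j f))).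
  by rewrite tgt_gmul// dt.
have c4 : tgt Gr d = src Gr (gamma (eps (j f))) by rewrite dt.
have conjE : conj_bisection Gr gamma d =
    gmul Gr (gmul Gr (ginv Gr (gamma (eps p))) d) (gamma (eps (j f))).
  by rewrite /conj_bisection dt -e1.
rewrite conjE.
(* By uniqueness of the dividing arrow, it suffices that the conjugate of [d] carries [R_ p] to
   [R_ (j f)]: the factor gamma(eps p) cancels with its inverse, and p . d = j f. *)
suff <- : act B (R_ p)
    (gmul Gr (gmul Gr (ginv Gr (gamma (eps p))) d) (gamma (eps (j f)))) =
    R_ (j f).
  rewrite division_act// src_gmul// src_gmul//.
  by rewrite /R_ /act_bisection (moment_act pg).
have c5 : tgt Gr (gamma (eps p)) = src Gr (gmul Gr (ginv Gr (gamma (eps p))) d).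
  by rewrite src_gmul.
have c6 : eps (R_ p) = src Gr (gmul Gr (ginv Gr (gamma (eps p))) d).
  by rewrite /R_ /act_bisection (moment_act pg).
rewrite act_gmul//; congr (act B _ _).
rewrite /R_ /act_bisection -act_gmul// gmulA// gmul_ginv -pg e1 unt_gmul.
exact: e2.
Qed.

End ActBisection.

(** * Connection forms and the two equivalences *)

Section Connection.
Variables (H : P -> {vspace 'rV[R]_(mdim P)}).
Hypothesis hH : horizontal_distribution B H.

Let VerE p v : exists2 h, h \in H p & v = Ver B H p v + h.
Proof.
have [_ /(_ p)[sum cap]] := hH.
exists (daddv_pi (H p) (vertical B p) v); first exact: memv_pi.
by rewrite /Ver daddv_pi_add// sum memvf.
Qed.

Let Ver_vertical p v : Ver B H p v \in vertical B p.
Proof. exact: memv_pi. Qed.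

Let Ver_id p v : v \in vertical B p -> Ver B H p v = v.
Proof. by have [_ /(_ p)[_ cap]] := hH; exact: daddv_pi_id. Qed.

Let Ver0P p v : v \in H p <-> Ver B H p v = 0.
Proof.
split=> [vH|v0]; last by have [h hHp ->] := VerE p v; rewrite v0 add0r.
have [_ /(_ p)[sum cap]] := hH.
have : daddv_pi (vertical B p) (H p) v + daddv_pi (H p) (vertical B p) v = v.
  by rewrite daddv_pi_add// sum memvf.
rewrite (daddv_pi_id _ vH) 1?capvC// => /eqP.
by rewrite -subr_eq0 addrK => /eqP.
Qed.

Let formE p v : connection_form B H p v = differential (D p) p (Ver B H p v).
Proof. by []. Qed.

Let form_eq0 p v : connection_form B H p v = 0 -> v \in H p.
Proof. by rewrite formE => /(division_inj (Ver_vertical p v))/Ver0P. Qed.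

(** Both sides agree on the vertical component by [anchor_division]. On horizontal vectors the form
    is zero, so there the identity reads d eps = 0. *)
Lemma MM_conditionP : MM_condition B H <->
  forall p v,
    anchor Gr (eps p) (connection_form B H p v) = differential eps p v.
Proof.
split=> [mm p v|an p v /Ver0P v0].
  have [h hHp {2}->] := VerE p v.
  by rewrite linearD /= (mm _ _ hHp) addr0 formE anchor_division.
by rewrite -an formE v0 !linear0.
Qed.

Lemma principal_connectionP : principal_connection B H <->
  (forall p v, anchor Gr (eps p) (connection_form B H p v) =
    differential eps p v) /\ equivariant B H.
Proof.
split=> [[mm HR]|[/MM_conditionP mm eqv]].
  split=> [|U gamma bis p v Up]; first exact/MM_conditionP.
  have gP := local_bisection_near bis Up.
  have [sR dR] := act_bisection_right_transl gP.
  set R_ := act_bisection B gamma in sR dR *.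
  have [h hHp vE] := VerE p v.
  have RvV : differential R_ p (Ver B H p v) \in vertical B (R_ p).
    rewrite memv_ker proj_act_bisection//.
    by have := Ver_vertical p v; rewrite memv_ker.
  have RhH : differential R_ p h \in H (R_ p).
    rewrite dR; last exact: mm.
    have : [set` H (R_ p)] (right_transl B p (gamma (eps p)) h); last by [].
    rewrite HR; first by exists h.
    by rewrite (nbhs_singleton gP).2.
  (* The differential of R_gamma preserves both summands of the splitting, hence commutes with the
     vertical projection. *)
  have VR : Ver B H (R_ p) (differential R_ p v) =
      differential R_ p (Ver B H p v).
    have Rv := etrans (congr1 (fun u => differential R_ p u) vE)
      (linearD (differential R_ p) _ _).
    apply: etrans (congr1 (fun u => Ver B H (R_ p) u) Rv) _.
    apply: etrans (linearD (Ver B H (R_ p)) _ _) _.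
    have /Ver0P Rh0 := RhH.
    exact: etrans (congr2 +%R (Ver_id RvV) Rh0) (addr0 _).
  apply: etrans (congr1 (fun u => differential (D (R_ p)) (R_ p) u) VR) _.
  rewrite formE; exact: Ad_division gP _ (Ver_vertical p v).
(* For a bisection through [g], equivariance makes the form of the translated vector equal to Ad
   applied to 0, and the kernel of the form is [H]. *)
have RH p g u : eps p = src Gr g -> u \in H p ->
    right_transl B p g u \in H (act B p g).
  move=> pg uH; have [U [gamma [bis Ug gg]]] := exists_local_bisection Gr g.
  rewrite -pg in Ug gg.
  have gP := local_bisection_near bis Ug.
  have [sR dR] := act_bisection_right_transl gP.
  rewrite -gg -(dR u (mm _ _ uH)); apply: form_eq0.
  rewrite (eqv _ _ bis _ _ Ug) formE.
  by have /Ver0P-> := uH; rewrite !linear0.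
split=> // p g pg; apply/seteqP; split=> [u /= uH|_ [u uH <-]]; last exact: RH.
(* For the reverse inclusion, [u] is translated back by the inverse arrow, which stays in [H] by
   [RH]. It remains to see that translating by [g] again gives [u]. *)
pose p' := act B p g; pose g' := ginv Gr g.
have p'g' : eps p' = src Gr g' by rewrite src_ginv (moment_act pg).
have p'p : act B p' g' = p.
  by rewrite /p' /g' -act_gmul ?src_ginv// gmul_ginv -pg act_unt.
exists (right_transl B p' g' u); first by have := RH _ _ _ p'g' uH; rewrite p'p.
have [U [gamma [bis Ug gg]]] := exists_local_bisection Gr g'.
rewrite -p'g' in Ug gg.
have gP := local_bisection_near bis Ug.
have [sR dR] := act_bisection_right_transl gP.
set R_ := act_bisection B gamma in sR dR.
rewrite -{1}gg -(dR u (mm _ _ uH)).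
have pg' : fiber_prod eps (src Gr) (p, g) := pg.
have := local_extension_xget (@act_smooth _ _ _ _ _ _ B) pg'.
rewrite /right_transl /differential_on; set m := xget _ _ => mP.
have sk : smooth_at (ginv Gr \o (gamma \o eps)) p'.
  apply: smooth_at_comp; last exact: ginv_smooth.
  by apply: smooth_at_comp; [exact: moment_smooth|exact: (nbhs_singleton gP).1].
have Rp' : R_ p' = p by rewrite /R_ /act_bisection gg.
have kp' : (ginv Gr \o (gamma \o eps)) p' = g by rewrite /= gg ginvK.
(* The identity to differentiate at [p'] is (q . gamma(eps q)) . gamma(eps q)^-1 = q. *)
have nm : \forall q \near p', m (R_ q, (ginv Gr \o (gamma \o eps)) q) = id q.
  have := mP; rewrite -{1}Rp' -kp' => /(near_smooth_pair sR sk).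
  have := near_continuous (moment_smooth B p').1 gP.
  apply: filterS2 => q [_ gq] [_ ->] /=.
    by rewrite /R_ /act_bisection -act_gmul ?src_ginv// gmul_ginv gq act_unt.
  by rewrite /fiber_prod /R_ /act_bisection /= src_ginv moment_act.
have sik : smooth_at (ginv Gr \o gamma) (eps p').
  by apply: smooth_at_comp; [exact: (nbhs_singleton gP).1|exact: ginv_smooth].
(* The arrow factor depends on the point only through the moment map, whose differential kills the
   horizontal vector [u]; so the identity involves the action on vectors (v, 0) only. *)
have k0 : differential (ginv Gr \o (gamma \o eps)) p' u = 0.
  apply: etrans (esym (differential_chain u erefl (moment_smooth B p') sik
    (near_all _ (fun=> erefl)))) _.
  exact: etrans (congr1 (fun t => differential _ _ t) (mm _ _ uH)) (linear0 _).
have E2 := differential_chain2 u Rp' kp' sR sk (nbhs_singleton mP).1 nm.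
have E1 := congr1 (fun t => differential m (p, g)
  (row_mx (differential R_ p' u) t)) (esym k0).
apply: (etrans E1); apply: (etrans E2); exact: differential_id.
Qed.

End Connection.
End PrincipalBundle.

Theorem proposition3p3 (R : realType) (G0 G : manifold R)
  (Gr : lie_groupoid G0 G) (M P : manifold R) (B : principal_bundle Gr M P)
  (H : P -> {vspace 'rV[R]_(mdim P)}) (hH : horizontal_distribution B H) :
  (MM_condition B H <->
    forall (p : P) (v : 'rV[R]_(mdim P)),
      anchor Gr (moment B p) (connection_form B H p v) =
      differential (moment B) p v) /\
  (principal_connection B H <->
    (forall (p : P) (v : 'rV[R]_(mdim P)),
      anchor Gr (moment B p) (connection_form B H p v) =
      differential (moment B) p v) /\
    equivariant B H).
Proof. by split; [exact: MM_conditionP|exact: principal_connectionP]. Qed.
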